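(* Let $e\geqslant 2$ and let $$G=\langle a,b,y_1,\dots ,y_e\,|\,[a,b]uv\rangle,$$ where $[a,b]=a^{-1}b^{-1}ab$, and $u,v$ are nontrivial reduced words in the letters $y_1,\dots ,y_e$ such that $u$ and $v$ have no common letters (no generator $y_m$ occurs in both $u$ and $v$). Let $r,s\in G$ be two elements whose normal closures in $G$ coincide. Then $r$ is conjugate in $G$ to $s$ or to $s^{-1}$.
   Context: The commutator convention is $[g,h]=g^{-1}h^{-1}gh$. The normal closure of an element $g$ in a group $A$ is the smallest normal subgroup of $A$ containing $g$. *)

(* Defs.v *)
From mathcomp Require Import all_boot.
Set Implicit Arguments. Unset Strict Implicit. Unset Printing Implicit Defensive.

(* A letter is (index of generator, inverted?) ; (i,false) = x_i, (i,true) = x_i^{-1}. *)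
Definition letter := (nat * bool)%type.
Definition word := seq letter.

Definition linv (x : letter) : letter := (x.1, ~~ x.2).
Definition winv (w : word) : word := rev (map linv w).

Definition isword (n : nat) (w : word) : bool := all (fun x : letter => x.1 < n) w.

Fixpoint reduced (w : word) : bool :=
  match w with
  | x :: ((y :: _) as t) => ~~ ((x.1 == y.1) && (x.2 != y.2)) && reduced t
  | _ => true
  end.

(* Equality in the group < x_0, ..., x_{n-1} | rels >: the congruence on words
   generated by free cancellation and by deletion of relators. *)
Inductive peq (n : nat) (rels : seq word) : word -> word -> Prop :=
  | peq_refl w : peq n rels w w
  | peq_sym w1 w2 : peq n rels w1 w2 -> peq n rels w2 w1
  | peq_trans w1 w2 w3 : peq n rels w1 w2 -> peq n rels w2 w3 -> peq n rels w1 w3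
  | peq_cancel p q (x : letter) : x.1 < n ->
      peq n rels (p ++ [:: x; linv x] ++ q) (p ++ q)
  | peq_rel p q r : r \in rels -> peq n rels (p ++ r ++ q) (p ++ q).

Inductive ncl (n : nat) (rels : seq word) (r : word) : word -> Prop :=
  | ncl_base : ncl n rels r r
  | ncl_one : ncl n rels r [::]
  | ncl_mul g h : ncl n rels r g -> ncl n rels r h -> ncl n rels r (g ++ h)
  | ncl_inv g : ncl n rels r g -> ncl n rels r (winv g)
  | ncl_conj w g : isword n w -> ncl n rels r g -> ncl n rels r (winv w ++ g ++ w)
  | ncl_eq g h : ncl n rels r g -> peq n rels g h -> ncl n rels r h.

(* Generators of G: a = x_0, b = x_1, y_m = x_(m+1) for 1 <= m <= e. *)
Definition gen_a : letter := (0, false).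
Definition gen_b : letter := (1, false).

Definition yword (e : nat) (u : word) : bool := all (fun x : letter => 2 <= x.1 <= e.+1) u.

Definition relator (u v : word) : word :=
  [:: linv gen_a; linv gen_b; gen_a; gen_b] ++ u ++ v.

Definition Geq (e : nat) (u v : word) := peq e.+2 [:: relator u v].
Definition Gncl (e : nat) (u v : word) := ncl e.+2 [:: relator u v].

(* Main.v *)
Require Import Defs.
From HB Require Import structures.
From mathcomp Require Import all_boot all_order all_algebra.
From mathcomp Require Import boolp zify.
Set Implicit Arguments. Unset Strict Implicit. Unset Printing Implicit Defensive.
Set Bullet Behavior "Strict Subproofs".

(** The substitutions [a := b^k a] and [b := a^k b] fix the relator and act on the exponents
    of [a] and [b] by elementary matrices, so one may assume that [r] has exponent 0 in [b].  The
    kernel K of the exponent of [b] on G is then free: with [y_(m,i) = b^-i y_m b^i] and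
    [a_i = b^-i a b^i] the relator reads [a_(i+1) = a_i (u_i v_i)^-1], so K is free on [a_0]
    and the [y_(m,i)].  Choose a conjugate of a translate of [r] lying in the free factor W
    generated by [a_0] and the [y_(m,i)] with i in a window as short as possible.  By the
    Freiheitssatz in K, the quotient of K by all the translates of [r] is an infinite chain of
    amalgams of one-relator groups, so an element of W killed in it is in the normal closure
    of [r] alone.  Hence the shortest windows for [r] and [s] have the same length, the
    corresponding conjugates have the same normal closure in the free group K, and Magnus'
    theorem for free groups concludes; when the window is empty, [r] and [s] are conjugate to
    powers of [a], which are compared in the abelianization.  Magnus' theorem and the
    Freiheitssatz for free groups are proved by the same window argument, K being there the
    kernel of the exponent of a letter, by induction on the length of the relator. *)

Local Open Scope group_scope.

Local Notation "{ 'hom' G -> H }" := (UMagmaMorphism.type G H)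
  (at level 0, G at level 98, H at level 99) : type_scope.

(** * Free groups as reduced words *)

Section FreeGroup.
Variable X : choiceType.
Implicit Types (l : X * bool) (w z : seq (X * bool)).

Definition sinv l : X * bool := (l.1, ~~ l.2).
Definition fred w := sorted (fun l m => m != sinv l) w.
Definition push l w := if w is m :: w' then
  if m == sinv l then w' else l :: w else [:: l].
Definition rednf w := foldr push [::] w.
Definition sinvw w := rev (map sinv w).

Lemma sinvK : involutive sinv.
Proof. by case=> x b; rewrite /sinv /= negbK. Qed.

Lemma sinvwK : involutive sinvw.
Proof.
by move=> w; rewrite /sinvw map_rev revK -map_comp map_id_in // => l _ /=; rewrite sinvK.
Qed.

Lemma fred_cons l w : fred (l :: w) -> fred w.
Proof. exact: path_sorted. Qed.

Lemma fred_push l w : fred w -> fred (push l w).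
Proof.
case: w => [|m w] //= h.
by case: eqP => [_|/eqP ne]; [exact: fred_cons h | rewrite /= ne].
Qed.

Lemma fred_foldr w z : fred z -> fred (foldr push z w).
Proof. by move=> hz; elim: w => //= l w; exact: fred_push. Qed.

Lemma pushK l w : fred w -> push (sinv l) (push l w) = w.
Proof.
case: w => [|m w] /=; first by rewrite sinvK eqxx.
case: eqP => [->|_ _] /=; last by rewrite sinvK eqxx.
by case: w => [|m' w] //= /andP[/negbTE ->].
Qed.

Lemma pushVK l w : fred w -> push l (push (sinv l) w) = w.
Proof. by move=> hw; rewrite -{1}[l]sinvK pushK. Qed.

(** Van der Waerden's trick: letters act on reduced words through [push], inverse letters by inverse
    maps, so left multiplication composes these actions. Associativity comes from this. *)
Lemma foldr_push z l w : fred z ->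
  foldr push z (push l w) = push l (foldr push z w).
Proof.
move=> hz; case: w => [|m w] //=; case: eqP => [->|//].
by rewrite pushVK // fred_foldr.
Qed.

Lemma foldr_foldr z u v : fred z ->
  foldr push z (foldr push v u) = foldr push (foldr push z v) u.
Proof. by move=> hz; elim: u => //= l u <-; rewrite foldr_push. Qed.

Lemma rednf_id w : fred w -> rednf w = w.
Proof.
elim: w => //= l w IH h; rewrite IH ?(fred_cons h) //.
by case: w h {IH} => //= m w /andP[/negbTE ->].
Qed.

Lemma fred_sinvw w : fred w -> fred (sinvw w).
Proof.
rewrite /fred /sinvw rev_sorted sorted_map => h; rewrite (eq_sorted (e' := fun l m => m != sinv l)) //.
by move=> l m /=; rewrite sinvK eq_sym.
Qed.

Lemma foldr_sinvw w : fred w -> foldr push w (sinvw w) = [::].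
Proof.
elim: w => //= l w IH h; rewrite /sinvw /= rev_cons foldr_rcons /= sinvK eqxx.
exact: IH (fred_cons h).
Qed.

Record freeg := Freeg { fgval : seq (X * bool); _ : fred fgval }.
HB.instance Definition _ := [isSub for fgval].
HB.instance Definition _ := [Choice of freeg by <:].

Lemma fgvalP (g : freeg) : fred (fgval g). Proof. exact: valP. Qed.

Definition fg_one := @Freeg [::] isT.
Definition fg_mul (g h : freeg) := Freeg (fred_foldr (fgval g) (fgvalP h)).
Definition fg_inv (g : freeg) := Freeg (fred_sinvw (fgvalP g)).

Lemma fg_mulA : associative fg_mul.
Proof. by move=> g h k; apply: val_inj; rewrite /= foldr_foldr ?fgvalP. Qed.
Lemma fg_mul1 : left_id fg_one fg_mul.
Proof. by move=> g; apply: val_inj. Qed.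
Lemma fg_mulr1 : right_id fg_one fg_mul.
Proof. by move=> g; apply: val_inj; exact: rednf_id (fgvalP g). Qed.
Lemma fg_mulV : left_inverse fg_one fg_inv fg_mul.
Proof. by move=> g; apply: val_inj; rewrite /= foldr_sinvw ?fgvalP. Qed.
Lemma fg_mulrV : right_inverse fg_one fg_inv fg_mul.
Proof.
move=> g; apply: val_inj; have := foldr_sinvw (fred_sinvw (fgvalP g)).
by rewrite sinvwK.
Qed.

HB.instance Definition _ :=
  isGroup.Build freeg fg_mulA fg_mul1 fg_mulr1 fg_mulV fg_mulrV.

Definition gen (x : X) : freeg := @Freeg [:: (x, false)] isT.
Definition sgen l : freeg := @Freeg [:: l] isT.

Lemma sgenE l : sgen l = if l.2 then (gen l.1)^-1 else gen l.1.
Proof. by apply: val_inj; case: l => x []. Qed.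

Lemma sgenV l : sgen (sinv l) = (sgen l)^-1.
Proof. by rewrite !sgenE; case: l => x [] /=; rewrite ?invgK. Qed.

Definition wval w : freeg := foldr (fun l g => sgen l * g) 1 w.

Lemma fgvalM (g h : freeg) : fgval (g * h) = foldr push (fgval h) (fgval g).
Proof. by []. Qed.

Lemma fgval_wval w : fgval (wval w) = rednf w.
Proof. by elim: w => //= l w <-. Qed.

Lemma wvalK (g : freeg) : wval (fgval g) = g.
Proof. by apply: val_inj; rewrite /= fgval_wval rednf_id ?fgvalP. Qed.

Lemma wval_cat u v : wval (u ++ v) = wval u * wval v.
Proof. by elim: u => [|l u /= ->]; rewrite ?mul1g ?mulgA. Qed.

Lemma wvalV w : wval (sinvw w) = (wval w)^-1.
Proof.
elim: w => [|l w IH] /=; first by rewrite invg1.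
by rewrite /sinvw /= rev_cons -cats1 wval_cat IH /= mulg1 sgenV invgM.
Qed.

Lemma size_push l w : size (push l w) <= (size w).+1.
Proof. by case: w => //= m w; case: ifP => //= _; lia. Qed.

Lemma size_fgM (g h : freeg) : size (fgval (g * h)) <= size (fgval g) + size (fgval h).
Proof.
rewrite fgvalM; elim: (fgval g) => //= l w IH.
by rewrite (leq_trans (size_push _ _)) // addSn ltnS.
Qed.

Lemma size_fgV (g : freeg) : size (fgval g^-1) = size (fgval g).
Proof. by rewrite /= size_rev size_map. Qed.

Lemma freeg_ind (C : freeg -> Prop) : C 1 ->
  (forall x g, C g -> C (gen x * g)) -> (forall x g, C g -> C ((gen x)^-1 * g)) ->
  forall g, C g.
Proof.
move=> C1 CM CV g; rewrite -(wvalK g); elim: (fgval g) => //= -[x b] w IH.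
by rewrite sgenE; case: b => /=; auto.
Qed.

(** * The universal property of the free group *)

Section Lift.
Variables (G : groupType) (f : X -> G).

Definition slift l : G := if l.2 then (f l.1)^-1 else f l.1.
Definition wlift w : G := foldr (fun l y => slift l * y) 1 w.
Definition lift (g : freeg) : G := wlift (fgval g).

Lemma slift_sinv l : slift (sinv l) = (slift l)^-1.
Proof. by rewrite /slift; case: l => x [] /=; rewrite ?invgK. Qed.

Lemma wlift_push l w : wlift (push l w) = slift l * wlift w.
Proof.
by case: w => [|m w] //=; case: eqP => [->|//]; rewrite slift_sinv mulVKg.
Qed.

Lemma liftM : {morph lift : g h / g * h}.
Proof.
move=> g h; rewrite /lift fgvalM; elim: (fgval g) => /= [|l w IH]; first by rewrite mul1g.
by rewrite wlift_push IH mulgA.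
Qed.

HB.instance Definition _ := isUMagmaMorphism.Build freeg G lift (erefl _, liftM).

Lemma liftV : {morph lift : g / g^-1}.
Proof. exact: gmulfV. Qed.

Lemma lift_gen x : lift (gen x) = f x.
Proof. by rewrite /lift /= mulg1. Qed.
End Lift.

Lemma eq_hom (G : groupType) (f f' : {hom freeg -> G}) :
  (forall x, f (gen x) = f' (gen x)) -> f =1 f'.
Proof.
move=> eff; elim/freeg_ind => [|x g IH|x g IH]; first by rewrite !gmulf1.
- by rewrite !gmulfM eff IH.
- by rewrite !gmulfM !gmulfV eff IH.
Qed.

(** * Retractions onto free factors *)

Definition ret (P : pred X) := lift (fun x => if P x then gen x else 1).
HB.instance Definition _ P := UMagmaMorphism.on (ret P).

(** Membership in the subgroup generated by the letters in [P], encoded as being fixed by a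
    retraction: it is boolean, and closure under the group operations is a rewriting step. *)
Definition supp (P : pred X) (g : freeg) := ret P g == g.

Lemma ret_gen P x : ret P (gen x) = if P x then gen x else 1.
Proof. exact: lift_gen. Qed.

Lemma ret1 P : ret P 1 = 1. Proof. by []. Qed.

Lemma retM P : {morph ret P : g h / g * h}.
Proof. exact: liftM. Qed.

Lemma retV P : {morph ret P : g / g^-1}.
Proof. exact: liftV. Qed.

Lemma retJ P : {morph ret P : g h / g ^ h}.
Proof. by move=> g h; rewrite !conjgE !retM retV. Qed.

Lemma supp1 P : supp P 1.
Proof. by rewrite /supp ret1. Qed.

Lemma suppM P g h : supp P g -> supp P h -> supp P (g * h).
Proof. by rewrite /supp retM => /eqP -> /eqP ->. Qed.

Lemma suppV P g : supp P g -> supp P g^-1.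
Proof. by rewrite /supp retV => /eqP ->. Qed.

Lemma suppJ P g h : supp P g -> supp P h -> supp P (g ^ h).
Proof. by move=> hg hh; rewrite conjgE !suppM ?suppV. Qed.

Lemma supp_gen (P : pred X) x : P x -> supp P (gen x).
Proof. by rewrite /supp ret_gen => ->. Qed.

Lemma supp_ret P g : supp P (ret P g).
Proof.
elim/freeg_ind: g => [|x g IH|x g IH]; rewrite ?ret1 ?supp1 // retM suppM // ?retV ?suppV //;
 by rewrite ret_gen; case: ifP => [/supp_gen //|_]; rewrite supp1.
Qed.

Lemma suppP P g : supp P g -> ret P g = g.
Proof. exact: eqP. Qed.

Lemma supp_wval P w : all (fun l => P l.1) w -> supp P (wval w).
Proof.
elim: w => [|l w IH] /=; first by rewrite supp1.
case/andP=> Pl /IH; apply: suppM; rewrite sgenE.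
by case: ifP => _; rewrite ?suppV // supp_gen.
Qed.

Lemma supp_all P g : all (fun l => P l.1) (fgval g) -> supp P g.
Proof. by rewrite -{2}[g]wvalK; exact: supp_wval. Qed.

Lemma supp_ind (P : pred X) (C : freeg -> Prop) : C 1 ->
  (forall g h, C g -> C h -> C (g * h)) -> (forall g, C g -> C g^-1) ->
  (forall x, P x -> C (gen x)) -> forall g, supp P g -> C g.
Proof.
move=> C1 CM CV Cg g /suppP <-.
have Cr x : C (ret P (gen x)) by rewrite ret_gen; case: ifP; auto.
by elim/freeg_ind: g => [|x g IH|x g IH]; rewrite ?ret1 // retM ?retV; auto.
Qed.

Lemma sub_supp (P Q : pred X) g : (forall x, P x -> Q x) -> supp P g -> supp Q g.
Proof.
move=> PQ; apply: (supp_ind (C := fun g => supp Q g)); [exact: supp1| exact: suppM| exact: suppV|].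
by move=> x /PQ; apply: supp_gen.
Qed.

Lemma hom_supp1 (G : groupType) (f : {hom freeg -> G}) (P : pred X) g :
  (forall x, P x -> f (gen x) = 1) -> supp P g -> f g = 1.
Proof.
move=> Pf; apply: (supp_ind (C := fun g => f g = 1)) => //.
- by rewrite gmulf1.
- by move=> x y hx hy; rewrite gmulfM hx hy mulg1.
- by move=> x hx; rewrite gmulfV hx invg1.
Qed.

Lemma eq_hom_supp (G : groupType) (f f' : {hom freeg -> G}) (P : pred X) g :
  (forall x, P x -> f (gen x) = f' (gen x)) -> supp P g -> f g = f' g.
Proof.
move=> Pf; apply: (supp_ind (C := fun g => f g = f' g)) => //.
- by rewrite !gmulf1.
- by move=> x y hx hy; rewrite !gmulfM hx hy.
- by move=> x hx; rewrite !gmulfV hx.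
Qed.

End FreeGroup.
Arguments gen {X} x.

Lemma supp_hom (X Y : choiceType) (f : {hom freeg X -> freeg Y}) (P : pred X) (Q : pred Y) g :
  (forall x, P x -> supp Q (f (gen x))) -> supp P g -> supp Q (f g).
Proof.
move=> PQ; apply: (supp_ind (C := fun g => supp Q (f g))) => //.
- by rewrite gmulf1 supp1.
- by move=> x y hx hy; rewrite gmulfM suppM.
- by move=> x hx; rewrite gmulfV suppV.
Qed.

(** * Normal closures and actions *)

Ltac gsolve := rewrite ?conjgE ?gnorm //.

Section NormalClosure.
Variable G : groupType.
Implicit Types (N S : G -> Prop) (x y : G).

Definition normal_pred N :=
  [/\ N 1, (forall x y, N x -> N y -> N (x * y)), (forall x, N x -> N x^-1)
    & (forall x y, N x -> N (x ^ y))].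

(** The intersection of all normal subgroups containing [S], so that unfolding the definition is the
    induction principle. *)
Definition nclos S x := forall N, normal_pred N -> (forall y, S y -> N y) -> N x.
Definition nclos1 y := nclos (eq y).

Lemma nclos_normal S : normal_pred (nclos S).
Proof.
split=> [|x y hx hy|x hx|x y hx] N nN SN; case: (nN) => N1 NM NV NJ //.
- exact: NM (hx _ nN SN) (hy _ nN SN).
- exact: NV (hx _ nN SN).
- exact: NJ (hx _ nN SN).
Qed.

Lemma nclos_in S x : S x -> nclos S x.
Proof. by move=> Sx N _; apply. Qed.

Lemma nclos1_in x : nclos1 x x.
Proof. exact: nclos_in. Qed.

Lemma nclos_sub S S' x : (forall y, S y -> nclos S' y) -> nclos S x -> nclos S' x.
Proof. by move=> SS'; apply=> //; apply: nclos_normal. Qed.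

Lemma nclos1P S x y : nclos1 x y -> nclos S x -> nclos S y.
Proof. by move=> hy hx; apply: nclos_sub hy => _ <-. Qed.

Lemma nclos1_1 x : nclos1 1 x -> x = 1.
Proof.
move=> /(_ (fun y => y = 1)); apply; last by move=> _ <-.
by split=> // [_ _ -> ->|_ ->|_ y ->]; rewrite ?mulg1 ?invg1 ?conj1g.
Qed.

Lemma nclosJ S x y : nclos S x -> nclos S (x ^ y).
Proof. by case: (nclos_normal S) => _ _ _; apply. Qed.

Lemma nclos1J x y z : nclos1 x y -> nclos1 (x ^ z) y.
Proof.
move=> h; apply: (nclos1P (S := eq (x ^ z)) h).
by rewrite -{2}[x](conjgK z); apply: nclosJ; apply: nclos_in.
Qed.

Lemma nclos1JK x y z : nclos1 (x ^ z) y -> nclos1 x y.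
Proof. by move=> /(nclos1J (z := z^-1)); rewrite conjgK. Qed.

(** Congruence modulo [N] is used in place of quotient groups. *)
Definition eqmod N x y := N (x^-1 * y).

Section EqMod.
Variables (N : G -> Prop) (nN : normal_pred N).
Local Notation "x ≡ y" := (eqmod N x y) (at level 70).

Lemma normal1 : N 1. Proof. by case: nN. Qed.
Lemma normalM x y : N x -> N y -> N (x * y). Proof. by case: nN => _ h _ _; apply: h. Qed.
Lemma normalV x : N x -> N x^-1. Proof. by case: nN => _ _ h _; apply: h. Qed.
Lemma normalJ x y : N x -> N (x ^ y). Proof. by case: nN => _ _ _; apply. Qed.
Lemma normalJK x y : N (x ^ y) -> N x.
Proof. by move=> /(normalJ y^-1); rewrite conjgK. Qed.

Lemma eqmod_refl x : x ≡ x. Proof. by rewrite /eqmod mulVg; exact: normal1. Qed.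
Lemma eqmod_eq x y : x = y -> x ≡ y. Proof. by move->; exact: eqmod_refl. Qed.
Lemma eqmod_sym x y : x ≡ y -> y ≡ x.
Proof. by move/normalV; rewrite invgM invgK. Qed.
Lemma eqmod_trans x y z : x ≡ y -> y ≡ z -> x ≡ z.
Proof. by move=> hx hy; rewrite /eqmod -[z](mulVKg y) mulgA; apply: normalM. Qed.
Lemma eqmodM x x' y y' : x ≡ x' -> y ≡ y' -> x * y ≡ x' * y'.
Proof.
move=> hx hy; have := normalM (normalJ y hx) hy.
by rewrite /eqmod; gsolve.
Qed.
Lemma eqmodV x y : x ≡ y -> x^-1 ≡ y^-1.
Proof. by move=> /eqmod_sym /normalJ -/(_ y^-1); rewrite /eqmod; gsolve. Qed.
Lemma eqmodJ x x' y y' : x ≡ x' -> y ≡ y' -> x ^ y ≡ x' ^ y'.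
Proof. by move=> hx hy; rewrite !conjgE; apply/eqmodM/eqmodM => //; apply: eqmodV. Qed.
Lemma eqmod1 x : x ≡ 1 <-> N x.
Proof.
rewrite /eqmod mulg1; split; last exact: normalV.
by move/normalV; rewrite invgK.
Qed.
Lemma eqmod_normal x y : x ≡ y -> N x -> N y.
Proof. by move=> /eqmod_sym xy /eqmod1 x1; apply/eqmod1/(eqmod_trans xy). Qed.
End EqMod.
End NormalClosure.

Section NormalHom.
Variables (G H : groupType) (f : {hom G -> H}).

Lemma normal_preim N : normal_pred N -> normal_pred (fun x => N (f x)).
Proof.
case=> N1 NM NV NJ; split=> [|x y hx hy|x hx|x y hx].
- by rewrite gmulf1.
- by rewrite gmulfM; apply: NM.
- by rewrite gmulfV; apply: NV.
- by rewrite gmulfJ; apply: NJ.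
Qed.

Lemma nclos_hom S S' x : (forall y, S y -> nclos S' (f y)) -> nclos S x -> nclos S' (f x).
Proof.
move=> SS' h; apply: (h (fun x => nclos S' (f x))); last exact: SS'.
exact: (normal_preim (nclos_normal S')).
Qed.

Lemma nclos1_hom x y : nclos1 x y -> nclos1 (f x) (f y).
Proof. by apply: nclos_hom => _ <-; apply: nclos1_in. Qed.
End NormalHom.

(** * Actions of free groups *)

Section Actions.
Variables (X : choiceType) (O : Type) (V : O -> Prop) (a b : X -> O -> O).

(** The maps [a] and [b] are mutually inverse only on the points satisfying [V]; this allows an
    action on a subset to be given by total functions on a simpler type. *)
Definition is_act := [/\ (forall x o, V o -> V (a x o)), (forall x o, V o -> V (b x o)),
   (forall x o, V o -> a x (b x o) = o) & (forall x o, V o -> b x (a x o) = o)].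

Definition sact (l : X * bool) := if l.2 then b l.1 else a l.1.
Definition wact (w : seq (X * bool)) o := foldr sact o w.
Definition fact (g : freeg X) o := wact (fgval g) o.

Hypothesis act : is_act.

Lemma sactV l o : V o -> V (sact l o).
Proof. by case: act => aV bV _ _; case: l => x []; [apply: bV | apply: aV]. Qed.

Lemma wactV w o : V o -> V (wact w o).
Proof. by move=> Vo; elim: w => //= l w; exact: sactV. Qed.

Lemma factV g o : V o -> V (fact g o). Proof. exact: wactV. Qed.

Lemma wact_push l w o : V o -> wact (push l w) o = sact l (wact w o).
Proof.
case: act => aV bV ab ba Vo; case: w => [|m w] //=; case: eqP => [->|//].
by have := wactV w Vo; case: l => x [] /= h; rewrite /sact /= ?ab ?ba.
Qed.

Lemma factM g h o : V o -> fact (g * h) o = fact g (fact h o).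
Proof.
move=> Vo; rewrite /fact fgvalM; elim: (fgval g) => //= l w IH.
by rewrite wact_push // IH.
Qed.

Lemma fact_gen x o : fact (gen x) o = a x o. Proof. by []. Qed.

Lemma factKV g o : V o -> fact g (fact g^-1 o) = o.
Proof. by move=> Vo; rewrite -factM // mulgV. Qed.

Lemma factVK g o : V o -> fact g^-1 (fact g o) = o.
Proof. by move=> Vo; rewrite -factM // mulVg. Qed.

(** An action of the subgroup on [P] is determined by its generators; this recognizes the two factor
    actions inside the one built for an amalgam. *)
Lemma fact_supp (A : freeg X -> O -> O) (P : pred X) :
  (forall x o, V o -> V (A x o)) -> (forall x y o, V o -> A (x * y) o = A x (A y o)) ->
  (forall o, V o -> A 1 o = o) -> (forall x o, P x -> V o -> a x o = A (gen x) o) ->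
  forall g o, supp P g -> V o -> fact g o = A g o.
Proof.
move=> AV AM A1 aA g o Pg; move: o; move: g Pg.
apply: supp_ind => [o Vo|x y hx hy o Vo|x hx o Vo|x Px o Vo].
- by rewrite A1.
- by rewrite factM // hy // hx ?AM //; apply: AV.
- have Vx : V (A x^-1 o) by apply: AV.
  by rewrite -[in LHS](A1 o) // -(mulgV x) AM // -hx // factVK.
- by rewrite fact_gen aA.
Qed.

Lemma fact_ker_normal : normal_pred (fun g => forall o, V o -> fact g o = o).
Proof.
split=> // [g h Kg Kh|g Kg|g h Kg] o Vo.
- by rewrite factM // Kh // Kg.
- by rewrite -[RHS](factVK g Vo) Kg.
- by rewrite conjgE !factM ?factV // Kg ?factVK //; apply: factV.
Qed.

End Actions.

(** * Coset actions in coordinates *)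

Section Transversal.
Variables (G : groupType) (H N : G -> Prop).
Hypotheses (H1 : H 1) (HM : forall x y, H x -> H y -> H (x * y)) (HV : forall x, H x -> H x^-1).
Hypotheses (nN : normal_pred N) (HN : forall x, H x -> N x -> x = 1).

Let rel x y := exists2 h, H h & eqmod N (h * y) x.

Let rel_refl x : rel x x.
Proof. by exists 1; rewrite // mul1g; apply: eqmod_refl. Qed.

Let rel_sym x y : rel x y -> rel y x.
Proof.
move=> [h Hh hyx]; exists h^-1; first exact: HV.
by rewrite -[y](mulKg h); apply: (eqmodM nN); [apply: eqmod_refl | apply: eqmod_sym].
Qed.

Let rel_trans x y z : rel x y -> rel y z -> rel x z.
Proof.
move=> [h Hh hyx] [k Hk kzy]; exists (h * k); first exact: HM.
apply: (eqmod_trans nN) hyx; rewrite -mulgA.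
by apply: (eqmodM nN) kzy; apply: eqmod_refl.
Qed.

(** [choose] is applied to the whole class of [x] modulo [H] and [N], so the representative depends
    on the class alone. *)
Let tN x := choose [pred y | `[< rel x y >]] x.

Let tNP x : rel x (tN x).
Proof. by have /chooseP /asboolP : [pred y | `[< rel x y >]] x by apply/asboolP/rel_refl. Qed.

Let tN_eq x y : rel x y -> tN x = tN y.
Proof.
move=> xy; rewrite /tN (@eq_choose _ _ [pred z | `[< rel y z >]]); last first.
  by move=> z /=; apply/asbool_equiv_eq; split; apply: rel_trans => //; apply: rel_sym.
by apply: choose_id; apply/asboolP; [exact: rel_sym | exact: rel_refl].
Qed.

Let hN_uniq t x h k : H h -> H k -> eqmod N (h * t) x -> eqmod N (k * t) x -> h = k.
Proof.
move=> Hh Hk hx kx; apply/eqP; rewrite -(inj_eq (mulgI h^-1)) mulVg eq_sym; apply/eqP/HN.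
  by apply: HM => //; apply: HV.
have := eqmod_trans nN hx (eqmod_sym nN kx).
rewrite /eqmod => h1; apply: (normalJK nN (y := t)); move: h1.
by gsolve.
Qed.

(* Right cosets of N, as a free left H-set: [x] lies in the class of [hN x * tN x]. *)
Lemma transversal : exists hN tN : G -> G,
  [/\ (forall x, H (hN x)), (forall x, eqmod N (hN x * tN x) x),
      (forall x y, eqmod N x y -> hN x = hN y /\ tN x = tN y)
    & (forall h x, H h -> hN (h * x) = h * hN x /\ tN (h * x) = tN x)].
Proof.
have /choice[hN hNP] x : exists h, H h /\ eqmod N (h * tN x) x.
  by case: (tNP x) => h; exists h.
exists hN, tN; split=> [x|x|x y xy|h x Hh]; [by case: (hNP x)|by case: (hNP x)| |].
- have txy : tN x = tN y.
    by apply: tN_eq; exists 1; rewrite // mul1g; apply: eqmod_sym.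
  split=> //; case: (hNP x) (hNP y) => Hx xP [Hy yP].
  by apply: (hN_uniq (t := tN x)) xP _ => //; rewrite txy; apply: (eqmod_trans nN yP); apply: eqmod_sym.
- have thx : tN (h * x) = tN x by apply: tN_eq; exists h => //; apply: eqmod_refl.
  split=> //; case: (hNP x) (hNP (h * x)) => Hx xP [Hy yP].
  apply: (hN_uniq _ _ yP) => //; first exact: HM.
  by rewrite thx -mulgA; apply: (eqmodM nN) xP; apply: eqmod_refl.
Qed.

(** This is left multiplication on the cosets of [N], each coset being written as a pair in [H]
    times a transversal. Since [H] meets [N] trivially the pair is unique, and [H] acts by
    multiplication on the first coordinate. *)
Lemma transversal_action : exists (T : G -> Prop) (t0 : G) (act : G -> G * G -> G * G),
  [/\ T t0, (forall x h t, H h -> T t -> H (act x (h, t)).1 /\ T (act x (h, t)).2),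
      (forall x y h t, act (x * y) (h, t) = act x (act y (h, t))),
      (forall k h t, H k -> H h -> T t -> act k (h, t) = (k * h, t))
    & [/\ (forall x h t, N x -> H h -> T t -> act x (h, t) = (h, t))
        & (forall x, act x (1, t0) = (1, t0) -> N x)]].
Proof.
have [hr [tr [Hhr ht_eq N_eq H_eq]]] := transversal.
have hrP x : hr (tr x) = 1 /\ tr (tr x) = tr x.
  have [h1 t1] := N_eq _ _ (ht_eq x); have [h2 t2] := H_eq _ (tr x) (Hhr x).
  by split; [apply: (mulgI (hr x)); rewrite -h2 h1 mulg1 | rewrite -t2 t1].
have actH k h t : H k -> H h -> hr t = 1 /\ tr t = t ->
    (hr (k * (h * t)), tr (k * (h * t))) = (k * h, t).
  move=> Hk Hh [ht tt]; rewrite mulgA; have [-> ->] := H_eq _ t (HM Hk Hh).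
  by rewrite ht tt mulg1.
exists (fun t => hr t = 1 /\ tr t = t), (tr 1), (fun x o => (hr (x * (o.1 * o.2)), tr (x * (o.1 * o.2)))).
split=> [|x h t Hh Tt|x y h t|//|] /=; rewrite ?hrP //; last split=> [x h t Nx Hh Tt|x [hx tx]].
- have [] := N_eq (x * y * (h * t)) (x * (hr (y * (h * t)) * tr (y * (h * t)))); last by move=> -> ->.
  by rewrite -mulgA; apply: (eqmodM nN); [exact: eqmod_refl|apply: (eqmod_sym nN)].
- have := actH 1 h t H1 Hh Tt; rewrite !mul1g => <-.
  have [] := N_eq (x * (h * t)) (h * t); last by move=> -> ->.
  by rewrite -[X in eqmod _ _ X]mul1g; apply: (eqmodM nN); [apply/(eqmod1 nN)|exact: eqmod_refl].
(* The base point represents the coset of [tr 1], so fixing it puts a conjugate of [x] in [N]. *)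
- have := ht_eq (x * (1 * tr 1)); rewrite hx tx !mul1g => h1.
  by apply: (normalJK nN (y := tr 1)); rewrite conjgE; exact: h1.
Qed.
End Transversal.

(** * Amalgams of one-relator quotients *)

(** Injectivity of a factor in an amalgamated product, without normal forms. The free group acts on
    triples [(h, t, u)]: one side moves [(h, t)] as a coset modulo [R], the other moves [(h, u)] as
    a coset modulo [S], and the common free factor multiplies [h] in both. All relators act
    trivially, hence so does [g], and its effect on [(h, t)] shows that it lies in the normal
    closure of [R]. *)
Lemma amalgam (X : choiceType) (P Q : pred X) (R S : freeg X -> Prop) g :
  (forall r, R r -> supp P r) -> (forall s, S s -> supp Q s) ->
  (forall h, supp (predI P Q) h -> nclos R h -> h = 1) ->
  (forall h, supp (predI P Q) h -> nclos S h -> h = 1) ->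
  supp P g -> nclos (fun x => R x \/ S x) g -> nclos R g.
Proof.
move=> RP SQ HR HS Pg Ng.
pose H : freeg X -> Prop := supp (predI P Q).
have H1 : H 1 by exact: supp1.
have HM x y : H x -> H y -> H (x * y) by exact: suppM.
have HV x : H x -> H x^-1 by exact: suppV.
have [T [t0 [aR [Tt0 aRV aRM aRH [aRN aRK]]]]] :=
  transversal_action H1 HM HV (nclos_normal R) HR.
have [U [u0 [aS [Uu0 aSV aSM aSH [aSN aSK]]]]] :=
  transversal_action H1 HM HV (nclos_normal S) HS.
pose V (o : freeg X * freeg X * freeg X) := [/\ H o.1.1, T o.1.2 & U o.2].
pose AR g (o : freeg X * freeg X * freeg X) := (aR g o.1, o.2).
pose AS g (o : freeg X * freeg X * freeg X) :=
  let o' := aS g (o.1.1, o.2) in ((o'.1, o.1.2), o'.2).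
have ARV x o : V o -> V (AR x o).
  by move: o => [[h t] u] [/= Hh Tt Uu]; have [] := aRV x h t Hh Tt; split.
have ASV x o : V o -> V (AS x o).
  by move: o => [[h t] u] [/= Hh Tt Uu]; have [] := aSV x h u Hh Uu; split.
have ARM x y o : AR (x * y) o = AR x (AR y o).
  by move: o => [[h t] u]; rewrite /AR /= aRM.
have ASM x y o : AS (x * y) o = AS x (AS y o).
  by move: o => [[h t] u]; rewrite /AS /= aSM -surjective_pairing.
have AR1 o : V o -> AR 1 o = o.
  by move: o => [[h t] u] [/= Hh Tt Uu]; rewrite /AR /= aRH // mul1g.
have AS1 o : V o -> AS 1 o = o.
  by move: o => [[h t] u] [/= Hh Tt Uu]; rewrite /AS /= aSH // mul1g.
have ARS k o : H k -> V o -> AR k o = AS k o.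
  by move: o => [[h t] u] Hk [/= Hh Tt Uu]; rewrite /AR /AS /= aRH // aSH.
(* A letter in both [P] and [Q] may act through either side, because [AR] and [AS] agree on [H]. *)
pose a x := if P x then AR (gen x) else AS (gen x).
pose b x := if P x then AR (gen x)^-1 else AS (gen x)^-1.
have act : is_act V a b.
  split=> x o Vo; rewrite /a /b; case: ifP => _; auto;
    by rewrite -?ARM -?ASM ?mulgV ?mulVg; auto.
have actR x o : supp P x -> V o -> fact a b x o = AR x o.
  by apply: (fact_supp act) => // {}x {}o Px _; rewrite /a Px.
have actS x o : supp Q x -> V o -> fact a b x o = AS x o.
  apply: (fact_supp act) => // {}x {}o Qx Vo; rewrite /a; case: ifP => // Px.
  by apply: ARS => //; apply: supp_gen; rewrite /= Px.
have Kg : forall o, V o -> fact a b g o = o.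
  apply: (Ng _ (fact_ker_normal act)) => x [Rx|Sx] [[h t] u] Vo.
    by rewrite actR ?RP // /AR /= aRN //; [exact: nclos_in | case: Vo | case: Vo].
  by rewrite actS ?SQ // /AS /= aSN //; [exact: nclos_in | case: Vo | case: Vo].
apply: aRK; have V0 : V ((1, t0), u0) by split.
by have := Kg _ V0; rewrite actR // => -[].
Qed.

(** * Windows *)

Definition cinto (X : choiceType) (P : pred X) (g : freeg X) := exists h, supp P (g ^ h).

Lemma cintoJ (X : choiceType) (P : pred X) (g h : freeg X) : cinto P (g ^ h) -> cinto P g.
Proof. by case=> k; rewrite -conjgM; exists (h * k). Qed.

(** The Freiheitssatz as a property of one relator: it is established by induction on length, so the
    window lemmas must take it as a hypothesis. *)
Definition freiheit (X : choiceType) (r : freeg X) :=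
  forall P : pred X, ~ cinto P r -> forall g, supp P g -> nclos1 r g -> g = 1.

Lemma freiheitJ (X : choiceType) (r h : freeg X) : freiheit r -> freiheit (r ^ h).
Proof.
move=> Fr P nP g Pg /nclos1JK; apply: (Fr P) => // -[k Pk]; apply: nP.
by exists (h^-1 * k); rewrite conjgM conjgK.
Qed.

(** All integer powers of one automorphism, so that translates add their indices. *)
Record zact (K : groupType) := ZAct {
  zfun :> int -> K -> K;
  zfunM : forall n, {morph zfun n : x y / x * y};
  zfun0 : forall x, zfun 0%R x = x;
  zfunD : forall m n x, zfun (m + n)%R x = zfun m (zfun n x) }.

Section ZAct.
Variables (K : groupType) (tau : zact K).

Lemma zfun1 n : tau n 1 = 1.
Proof. by apply: (mulgI (tau n 1)); rewrite -zfunM !mulg1. Qed.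

HB.instance Definition _ n := isUMagmaMorphism.Build K K (zfun tau n) (zfun1 n, zfunM tau n).

Lemma zfunK n : cancel (tau n) (tau (- n)%R).
Proof. by move=> x; rewrite -zfunD GRing.addNr zfun0. Qed.

Lemma zfunVK n : cancel (tau (- n)%R) (tau n).
Proof. by move=> x; rewrite -zfunD GRing.subrr zfun0. Qed.

Lemma zfunJ n x y : tau n (x ^ y) = tau n x ^ tau n y.
Proof. exact: gmulfJ. Qed.

Lemma zfunV n x : tau n x^-1 = (tau n x)^-1.
Proof. exact: gmulfV. Qed.

Lemma zfun_nclos1 n x y : nclos1 x y -> nclos1 (tau n x) (tau n y).
Proof. exact: nclos1_hom. Qed.

Lemma zfun_nclos1K n x y : nclos1 (tau n x) (tau n y) -> nclos1 x y.
Proof. by move=> h; have := zfun_nclos1 (n := (- n)%R) h; rewrite !zfunK. Qed.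

Definition orbit_of (r : K) x := exists n, x = tau n r.

Lemma nclos_orbit n r g : nclos (orbit_of r) g -> nclos (orbit_of r) (tau n g).
Proof.
apply: nclos_hom => _ [m ->]; apply: nclos_in.
by exists (n + m)%R; rewrite zfunD.
Qed.

Lemma nclos_orbitJ n r h g : nclos (orbit_of r) g -> nclos (orbit_of (tau n r ^ h)) g.
Proof.
apply: nclos_sub => _ [m ->].
have -> : tau m r = tau (m - n)%R (tau n r ^ h) ^ (tau (m - n)%R h)^-1.
  by rewrite zfunJ conjgK -zfunD GRing.subrK.
by apply: nclosJ; apply: nclos_in; exists (m - n)%R.
Qed.
End ZAct.
Arguments zfun : simpl never.

Section Windows.
Variables (Y : choiceType) (lev : Y -> option int) (tau : zact (freeg Y)).
Hypothesis up : forall y j, lev y = Some j ->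
  supp (fun z => lev z == Some (j + 1)%R) (tau 1%R (gen y)).
Hypothesis up0 : forall y, lev y = None ->
  supp (fun z => (lev z == None) || (lev z == Some 0%R)) (tau 1%R (gen y)).
Hypothesis down : forall y j, lev y = Some j ->
  supp (fun z => lev z == Some (j - 1)%R) (tau (-1)%R (gen y)).
Hypothesis down0 : forall y, lev y = None ->
  supp (fun z => (lev z == None) || (lev z == Some (-1)%R)) (tau (-1)%R (gen y)).

(** A half-open interval of levels. Generators without a level belong to every window: these are the
    letters other than [t] in the free group case, and the copies of [a] in the commutator case. *)
Definition window (a b : int) : pred Y :=
  fun y => if lev y is Some j then (a <= j < b)%R else true.

Lemma sub_window a b a' b' g : (a' <= a)%R -> (b <= b')%R ->
  supp (window a b) g -> supp (window a' b') g.
Proof. by move=> ha hb; apply: sub_supp => y; rewrite /window; case: (lev y) => // j; lia. Qed.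

Lemma window_up a b a' b' g : (a' <= 0 < b')%R -> (a' <= a + 1)%R -> (b + 1 <= b')%R ->
  supp (window a b) g -> supp (window a' b') (tau 1%R g).
Proof.
move=> h0 ha hb; apply: supp_hom => y; rewrite {1}/window; case E: (lev y) => [j|] hj.
- by apply: sub_supp (up E) => z /= /eqP; rewrite /window => ->; lia.
- by apply: sub_supp (up0 E) => z /= /orP[]/eqP; rewrite /window => ->.
Qed.

Lemma window_down a b a' b' g : (a' <= -1 < b')%R -> (a' <= a - 1)%R -> (b - 1 <= b')%R ->
  supp (window a b) g -> supp (window a' b') (tau (-1)%R g).
Proof.
move=> h0 ha hb; apply: supp_hom => y; rewrite {1}/window; case E: (lev y) => [j|] hj.
- by apply: sub_supp (down E) => z /= /eqP; rewrite /window => ->; lia.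
- by apply: sub_supp (down0 E) => z /= /orP[]/eqP; rewrite /window => ->.
Qed.

(** The upper end stays at [l] whatever the number of steps, so that all the lower translates share
    a window whose intersection with [window 0 l.+1] is [window 0 l]. *)
Lemma window_downn (i l : nat) g : supp (window 0 l.+1) g ->
  supp (window (- i.+1%:Z) l) (tau (- i.+1%:Z)%R g).
Proof.
move=> Wg; elim: i => [|i IH]; first by apply: window_down Wg; lia.
have -> : (- i.+2%:Z = -1 + - i.+1%:Z)%R by lia.
by rewrite zfunD; apply: window_down IH; lia.
Qed.

Lemma window_total g : exists n : nat, supp (window (- n%:Z) n) g.
Proof.
have : supp predT g by apply: supp_all; apply: all_predT.
apply: (supp_ind (C := fun g => exists n : nat, supp (window (- n%:Z) n) g)).
- by exists 0%N; apply: supp1.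
- move=> {}g h [m hm] [n hn]; exists (m + n)%N; apply: suppM.
    by apply: sub_window hm; lia.
  by apply: sub_window hn; lia.
- by move=> {}g [m hm]; exists m; apply: suppV.
- move=> y _; exists (if lev y is Some j then (absz j).+1 else 0%N).
  by apply: supp_gen; rewrite /window; case: (lev y) => // j; lia.
Qed.

Lemma window_shift g : exists n l : nat, supp (window 0 l) (tau n g).
Proof.
have [n hn] := window_total g; exists n, (n + n)%N.
(* The bound on [k] keeps the lower end nonpositive, as [window_up] requires: a generator without
   level may produce letters of level 0. *)
suff: forall k, (k <= n)%N -> supp (window (k%:Z - n%:Z) (n + k)%N) (tau k g).
  by move/(_ n (leqnn n)); rewrite GRing.subrr.
elim=> [_|k IH hk]; first by rewrite zfun0; apply: sub_window hn; lia.
have -> : (k.+1%:Z = 1 + k%:Z)%R by lia.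
by rewrite zfunD; apply: window_up (IH _); lia.
Qed.

Section Chain.
Variables (r : freeg Y) (l : nat).
Hypothesis Wr : supp (window 0 l.+1) r.
Hypothesis Fr : forall h, supp (window 0 l) h -> nclos1 r h -> h = 1.
Hypothesis Fr' : forall h, supp (window 0 l) h -> nclos1 (tau (-1)%R r) h -> h = 1.

(* Each step amalgamates one more translate of [<window 0 l.+1 | r>] along [window 0 l]. *)
Lemma window_chain (m k : nat) g : (k <= m)%N -> supp (window 0 l.+1) (tau k g) ->
  nclos (fun x => exists2 i : nat, (i <= m)%N & x = tau (- i%:Z)%R r) g ->
  nclos1 (tau (- k%:Z)%R r) g.
Proof.
elim: m k g => [|m IH] k g.
  rewrite leqn0 => /eqP -> _; apply: nclos_sub => x [i]; rewrite leqn0 => /eqP -> ->.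
  exact: nclos_in.
move=> hk Wg Ng.
pose R x := exists2 i : nat, (i <= m)%N & x = tau (- i.+1%:Z)%R r.
have RP x : R x -> supp (window (- m.+1%:Z) l) x.
  case=> i hi ->; apply: sub_window (window_downn i Wr); lia.
have SP x : r = x -> supp (window 0 l.+1) x by move=> <-.
have R1 x : nclos R x ->
    nclos (fun x => exists2 i : nat, (i <= m)%N & x = tau (- i%:Z)%R r) (tau 1%R x).
  apply: nclos_hom => _ [i hi ->]; apply: nclos_in; exists i => //.
  by rewrite /= -zfunD; congr (tau _ r); lia.
have Wl h : supp (predI (window (- m.+1%:Z) l) (window 0 l.+1)) h -> supp (window 0 l) h.
  by apply: sub_supp => y; rewrite /= /window; case: (lev y) => // j; lia.
(* Moved up by one, [h] falls under the induction hypothesis with [k = 0]; so [h] is a consequence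
   of the translate of [r] by -1 alone, and [Fr'] makes it trivial. *)
have HR h : supp (window 0 l) h -> nclos R h -> h = 1.
  move=> Wh /R1 /IH -/(_ 0%N) h1; apply: Fr' => //.
  apply: (zfun_nclos1K (n := 1%R) (tau := tau)); rewrite -zfunD GRing.subrr.
  by apply: h1 => //; rewrite zfun0; apply: window_up Wh; lia.
have {}Ng : nclos (fun x => R x \/ r = x) g.
  apply: nclos_sub Ng => _ [[|i] hi ->]; apply: nclos_in; last by left; exists i.
  by right; rewrite zfun0.
(* For [k = 0] the element lies in the factor of [r]. Otherwise it lies in the factor of the lower
   translates, and one translation upwards leads to the induction hypothesis. *)
case: k => [|k] in hk Wg *.
{ rewrite !zfun0 in Wg *.
  apply: (amalgam (P := window 0 l.+1) (Q := window (- m.+1%:Z) l) (R := eq r) (S := R)) => //.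
  - by move=> h Wh; apply: Fr; apply: Wl; move: Wh; apply: sub_supp => y /andP[/= -> ->].
  - by move=> h Wh; apply: HR; apply: Wl; move: Wh; apply: sub_supp => y /andP[/= -> ->].
  - by apply: nclos_sub Ng => x [Rx|Sx]; apply: nclos_in; [right|left]. }
have Pg : supp (window (- m.+1%:Z) l) g.
  rewrite -[g](zfunK tau k.+1); apply: sub_window (window_downn k Wg); lia.
have: nclos R g.
  by apply: (amalgam (P := window (- m.+1%:Z) l) (Q := window 0 l.+1) (S := eq r)) => //
    h /Wl; [apply: HR | apply: Fr].
move/R1 => /(IH k); rewrite -zfunD.
have -> : (k%:Z + 1 = k.+1%:Z)%R by lia.
move=> /(_ hk Wg) => h1; apply: (zfun_nclos1K (n := 1%R) (tau := tau)).
by rewrite -zfunD (_ : (1 + - k.+1%:Z = - k%:Z)%R); last lia.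
Qed.

(** Only finitely many translates are involved, say with indices between [-n] and [n]. Translating
    everything by [-n] makes the indices run from 0 down to [-2n], and [g] becomes the case [k = n]
    of the chain. *)
Lemma window_freiheit g : supp (window 0 l.+1) g -> nclos (orbit_of tau r) g -> nclos1 r g.
Proof.
move=> Wg Ng.
have [n Nn] : exists n : nat, nclos (fun x => exists2 i : int, (- n%:Z <= i <= n)%R & x = tau i r) g.
{   apply: (Ng (fun g => exists n : nat,
    nclos (fun x => exists2 i : int, (- n%:Z <= i <= n)%R & x = tau i r) g)); last first.
    by move=> _ [i ->]; exists (absz i); apply: nclos_in; exists i => //; lia.
  split=> [|x y [m hm] [n hn]|x [m hm]|x y [m hm]].
  - by exists 0%N; apply: (normal1 (nclos_normal _)).
  - exists (m + n)%N; apply: (normalM (nclos_normal _)).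
      by apply: nclos_sub hm => _ [i hi ->]; apply: nclos_in; exists i => //; lia.
    by apply: nclos_sub hn => _ [i hi ->]; apply: nclos_in; exists i => //; lia.
  - by exists m; apply: (normalV (nclos_normal _)).
  - by exists m; apply: nclosJ. }
apply: (zfun_nclos1K (n := (- n%:Z)%R) (tau := tau)).
apply: (@window_chain (n + n) n); [lia | by rewrite zfunVK |].
apply: nclos_hom Nn => _ [i hi ->]; apply: nclos_in.
exists (absz (n%:Z - i)%R); first lia.
by rewrite /= -zfunD; congr (tau _ r); lia.
Qed.
End Chain.

(** The window is the shortest one over all translates and conjugates of [r]. Minimality supplies
    the hypotheses of the chain, since no translate can be conjugated into a window shorter by
    one. *)
Lemma window_dichotomy r : (forall i, freiheit (tau i r)) ->
  (exists i, cinto (window 0 0) (tau i r)) \/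
  exists (l : nat) i h, let r' := tau i r ^ h in
    [/\ supp (window 0 l.+1) r', (forall j, ~ cinto (window 0 l) (tau j r'))
      & forall g, supp (window 0 l.+1) g -> nclos (orbit_of tau r) g -> nclos1 r' g].
Proof.
move=> Fr.
have ex : exists l, `[< exists i, cinto (window 0 l%:Z) (tau i r) >].
  have [n [l hl]] := window_shift r; exists l; apply/asboolP; exists n, 1.
  by rewrite conjg1.
case: (ex_minnP ex) => -[|l] /asboolP[i [h Wh]] min; first by left; exists i, h.
right; exists l, i, h => r'.
have nW j : ~ cinto (window 0 l) (tau j r').
  rewrite zfunJ -zfunD => /cintoJ hj; have := min l.
  by rewrite ltnn => no; suff: false by []; apply: no; apply/asboolP; exists (j + i)%R.
split=> // g Wg Ng; apply: (window_freiheit Wh) => // [k Wk|k Wk|].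
- by apply: freiheitJ Wk; [exact: Fr | have := nW 0%R; rewrite zfun0].
- rewrite zfunJ -zfunD; apply: freiheitJ Wk; first exact: Fr.
  by rewrite zfunD -zfunJ; apply: nW.
- exact: nclos_orbitJ.
Qed.

Lemma window_pair r s : (forall i, freiheit (tau i r)) -> (forall i, freiheit (tau i s)) ->
  nclos (orbit_of tau r) s -> nclos (orbit_of tau s) r ->
  ((exists i, cinto (window 0 0) (tau i r)) /\ (exists i, cinto (window 0 0) (tau i s))) \/
  exists i j h k, nclos1 (tau i r ^ h) (tau j s ^ k) /\ nclos1 (tau j s ^ k) (tau i r ^ h).
Proof.
move=> Fr Fs Ns Nr.
(* The window of [x] has length [l.+1] and that of [y] length [m]. If [y] had the shorter one, the
   Freiheitssatz would make [y] trivial, hence [x] too, which would then fit in any window. *)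
have short (x y : freeg Y) (l m : nat) i j h k : (forall i, freiheit (tau i x)) ->
    nclos (orbit_of tau x) y -> nclos (orbit_of tau y) x ->
    (forall j, ~ cinto (window 0 l) (tau j (tau i x ^ h))) ->
    (forall g, supp (window 0 l.+1) g -> nclos (orbit_of tau x) g -> nclos1 (tau i x ^ h) g) ->
    supp (window 0 m) (tau j y ^ k) -> (m <= l)%N -> False.
  move=> Fx Nx Ny nW hN Wy ml.
  have Wy' : supp (window 0 l) (tau j y ^ k) by apply: sub_window Wy; lia.
  have y1 : tau j y ^ k = 1.
    apply: (freiheitJ (h := h) (Fx i)) Wy' _; first by have := nW 0%R; rewrite zfun0.
    apply: hN; first by apply: sub_window Wy; lia.
    by apply: nclosJ; apply: nclos_orbit.
  have {}y1 : y = 1.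
    by apply: (can_inj (zfunK tau j)); apply: (@conjg_inj _ k); rewrite y1 zfun1 conj1g.
  apply: (nW 0%R); exists 1; rewrite zfun0 (_ : x = 1) ?zfun1 ?conj1g ?supp1 //.
  apply: nclos1_1; apply: nclos_sub Ny => _ [n ->]; rewrite y1 zfun1; exact: nclos_in.
have [Lr|[l [i [h [Wr nr hr]]]]] := window_dichotomy Fr;
have [Ls|[m [j [k [Ws ns hs]]]]] := window_dichotomy Fs.
- by left.
- by case: Lr => i [h Wh]; case: (short s r m 0%N j i k h).
- by case: Ls => j [k Wk]; case: (short r s l 0%N i j h k).
- have [lm|ml|e] := ltngtP l m; first by case: (short s r m l.+1 j i k h).
    by case: (short r s l m.+1 i j h k).
  right; exists i, j, h, k; split.
    by apply: hr; [rewrite e | apply: nclosJ; apply: nclos_orbit].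
  by apply: hs; [rewrite -e | apply: nclosJ; apply: nclos_orbit].
Qed.
End Windows.

(** * Exponents and adjunction of roots *)

Definition gpow (G : groupType) (x : G) (n : int) : G :=
  match n with Posz m => x ^+ m | Negz m => x ^- m.+1 end.

Lemma gpowS (G : groupType) (x : G) n : gpow x (n + 1)%R = gpow x n * x.
Proof.
case: n => [n|[|n]]; first by rewrite -PoszD addn1 /= expgSr.
  by rewrite /= mulVg.
have -> : (Negz n.+1 + 1 = Negz n)%R by lia.
by rewrite /gpow [x ^+ n.+2]expgS invgM mulgVK.
Qed.

Lemma gpowB (G : groupType) (x : G) n : gpow x (n - 1)%R = gpow x n * x^-1.
Proof. by rewrite -{2}[n](GRing.subrK 1%R) gpowS mulgK. Qed.

Lemma gpowD (G : groupType) (x : G) m n : gpow x (m + n)%R = gpow x m * gpow x n.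
Proof.
elim: n => [|n IH|n IH]; first by rewrite GRing.addr0 mulg1.
  by rewrite -addn1 PoszD GRing.addrA !gpowS IH mulgA.
by rewrite -addn1 PoszD GRing.opprD GRing.addrA !gpowB IH mulgA.
Qed.

Lemma gpowN (G : groupType) (x : G) n : gpow x (- n)%R = (gpow x n)^-1.
Proof. by apply: (mulgI (gpow x n)); rewrite -gpowD GRing.subrr mulgV. Qed.

Lemma gmulf_gpow (G H : groupType) (f : {hom G -> H}) x n : f (gpow x n) = gpow (f x) n.
Proof. by case: n => n; rewrite /gpow ?gmulfV gmulfXn. Qed.

Lemma supp_gpow (X : choiceType) (P : pred X) g n : supp P g -> supp P (gpow g n).
Proof.
move=> Pg; elim: n => [|n IH|n IH]; first exact: supp1.
  by rewrite -addn1 PoszD gpowS suppM.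
by rewrite -addn1 PoszD GRing.opprD gpowB suppM // suppV.
Qed.

(** A copy of the integers carrying the group structure expected by [lift], so that an exponent is a
    homomorphism like any other. *)
Definition zint : Type := int.
HB.instance Definition _ := Choice.on zint.
HB.instance Definition _ := isGroup.Build zint (@GRing.addrA int) (@GRing.add0r int)
  (@GRing.addr0 int) (@GRing.addNr int) (@GRing.subrr int).

Section Expo.
Variables (X : choiceType) (c : X).

Definition expo : freeg X -> zint := lift (fun x => if x == c then 1%R : zint else 0%R).
HB.instance Definition _ := UMagmaMorphism.on expo.

Lemma expoM g h : expo (g * h) = (expo g + expo h)%R.
Proof. exact: liftM. Qed.

Lemma expoV g : expo g^-1 = (- expo g)%R.
Proof. exact: liftV. Qed.

Lemma expoJ g h : expo (g ^ h) = expo g.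
Proof. by rewrite conjgE !expoM expoV GRing.addrC GRing.addrK. Qed.

Lemma expo_gen x : expo (gen x) = if x == c then 1%R else 0%R.
Proof. exact: lift_gen. Qed.

Lemma expo_gpow g n : expo (gpow g n) = (n * expo g)%R.
Proof.
elim: n => [|n IH|n IH]; first by rewrite GRing.mul0r.
  by rewrite -addn1 PoszD gpowS expoM IH GRing.mulrDl GRing.mul1r.
by rewrite -addn1 PoszD GRing.opprD gpowB expoM IH expoV GRing.mulrDl GRing.mulN1r.
Qed.

Lemma expo_supp0 (P : pred X) g : ~~ P c -> supp P g -> expo g = 0%R.
Proof.
move=> Pc; apply: hom_supp1 => x Px; rewrite /= expo_gen; case: eqP => // e.
by rewrite -e Px in Pc.
Qed.

Lemma supp_pred1 g : supp (pred1 c) g -> g = gpow (gen c) (expo g).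
Proof.
apply: (supp_ind (C := fun g => g = gpow (gen c) (expo g))) => //.
- by move=> {}g h {1}-> {1}->; rewrite expoM gpowD.
- by move=> {}g {1}->; rewrite expoV gpowN.
- by move=> x /eqP ->; rewrite expo_gen eqxx.
Qed.
End Expo.

Lemma supp_letters (X : choiceType) (P : pred X) g :
  supp P g -> all (fun l => P l.1) (fgval g).
Proof.
apply: (supp_ind (C := fun g => all (fun l => P l.1) (fgval g))) => //.
- move=> {}g h; rewrite fgvalM; elim: (fgval g) => //= l w IH /andP[Pl Pw] Ph.
  by case: (foldr (@push X) _ w) (IH Pw Ph) => [|m w'] /=; [rewrite Pl | case: ifP => _ /=; [case/andP | rewrite Pl]].
- by move=> {}g; rewrite /= all_rev all_map; apply: sub_all => -[].
- by move=> x Px; rewrite /= Px.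
Qed.

Section Root.
Variables (X : choiceType) (x : X) (p : nat).
Hypothesis p_gt0 : (0 < p)%N.

Definition rootmap0 : freeg X -> freeg X := lift (fun y => if y == x then gen x ^+ p else gen y).
HB.instance Definition _ := UMagmaMorphism.on rootmap0.

(* [rootmap0] embeds the free group in the one where [x] has a [p]-th root; the latter
   acts on [p] copies of the former, the root permuting them cyclically. *)
Let a (y : X) (o : freeg X * nat) := if y == x
  then if o.2.+1 == p then (gen x * o.1, 0%N) else (o.1, o.2.+1)
  else if o.2 == 0%N then (gen y * o.1, 0%N) else o.
Let b (y : X) (o : freeg X * nat) := if y == x
  then if o.2 == 0%N then ((gen x)^-1 * o.1, p.-1) else (o.1, o.2.-1)
  else if o.2 == 0%N then ((gen y)^-1 * o.1, 0%N) else o.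
Let V (o : freeg X * nat) := (o.2 < p)%N.

Let act : is_act V a b.
Proof.
rewrite /V; split=> y [f i] hi.
- by rewrite /a; case: ifP => _; case: ifP => /= hp; move: hi; rewrite /= ?p_gt0 //; lia.
- by rewrite /b; case: ifP => _; case: ifP => /= hp; move: hi; rewrite /= ?p_gt0 //; lia.
- rewrite /a /b; case: ifP => /= yx; case: (i =P 0%N) => /= [->|i0]; rewrite ?yx /=.
  + by rewrite prednK // eqxx mulVKg.
  + have -> : (i.-1.+1 == p) = false by move: hi => /=; lia.
    by congr (_, _); lia.
  + by rewrite mulVKg.
  + by case: eqP.
- rewrite /a /b; case: ifP => /= yx.
    by case: (i.+1 =P p) => /= [ip|ip]; rewrite !yx /= ?mulKg -?ip.
  by case: (i =P 0%N) => /= [->|/eqP/negbTE i0]; rewrite !yx /= ?mulKg // i0.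
Qed.

Let factRw w f i u : wact a b w (f * u, i) = ((wact a b w (f, i)).1 * u, (wact a b w (f, i)).2).
Proof.
elim: w => //= l w ->; case: (wact a b w (f, i)) => f' i' /=; case: l => y [];
 rewrite /sact /a /b /=; by do 2?case: eqP => //= _; rewrite ?mulgA.
Qed.

Let factR g i u : fact a b g (u, i) = ((fact a b g (1, i)).1 * u, (fact a b g (1, i)).2).
Proof. by rewrite -{1}[u]mul1g; exact: factRw. Qed.

Let fact_pow k f : (k < p)%N -> fact a b (gen x ^+ k) (f, 0%N) = (f, k).
Proof.
elim: k => //= k IH hk; rewrite expgS (factM act) // IH; last exact: ltnW.
by rewrite fact_gen /a eqxx (ltn_eqF hk).
Qed.

(** The embedded group acts by multiplication on the copy of index 0, and on the other copies only
    through its retraction onto the powers of [x]. *)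
Let B g (o : freeg X * nat) := (if o.2 == 0%N then g * o.1 else ret (pred1 x) g * o.1, o.2).

Let fact_root0 g o : V o -> fact a b (rootmap0 g) o = B g o.
Proof.
have : supp predT g by apply: supp_all; apply: all_predT.
move=> Pg; move: o; move: g Pg; apply: supp_ind => [|g h hg hh|g hg|y _] [f i] Vo.
- by rewrite /B /= !mul1g; case: ifP.
- by rewrite gmulfM (factM act) // hh // hg // /B /=; case: ifP => i0; rewrite ?i0 ?retM mulgA.
- rewrite gmulfV; have e : B g (B g^-1 (f, i)) = (f, i).
    by rewrite /B /=; case: ifP => i0; rewrite ?i0 ?retV mulVKg.
  by rewrite -{1}e -hg // (factVK act).
- rewrite /rootmap0 lift_gen /B /= ret_gen /=; case: eqP => [->|ne]; last first.
    by rewrite fact_gen /a (introF eqP ne) /=; case: eqP => [->|_] //; rewrite mul1g.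
  rewrite -(fact_pow f Vo) -(factM act) // -expgnDr addnC expgnDr (factM act) //.
  have -> : fact a b (gen x ^+ p) (f, 0%N) = (gen x * f, 0%N).
    rewrite -(prednK p_gt0) expgS (factM act) // fact_pow ?prednK //.
    by rewrite fact_gen /a eqxx /= prednK // eqxx.
  by rewrite fact_pow //; case: ifP.
Qed.

Lemma rootmap0_inj g : rootmap0 g = 1 -> g = 1.
Proof. by move=> g1; have := @fact_root0 g (1, 0%N) p_gt0; rewrite g1 /B /= mulg1 => /(congr1 fst). Qed.

(** Both sides of the conjugacy act on [(1, 0)]. The copy into which [h] sends this point decides:
    index 0 yields a conjugator in the smaller group, any other index conjugates [s] to a power of
    [x]. *)
Lemma rootmap0_conj r s h : rootmap0 r ^ h = rootmap0 s ->
  (exists c, r ^ c = s) \/ cinto (pred1 x) s.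
Proof.
move=> rs; have e : rootmap0 r * h = h * rootmap0 s by rewrite -rs conjgE mulVKg.
have V1 : V (1, 0%N) by [].
have := congr1 (fun g => fact a b g (1, 0%N)) e.
rewrite /= !(factM act) // fact_root0; last exact: (factV act).
rewrite fact_root0 // /B /= mulg1 (factR h 0 s).
case: (fact a b h (1, 0%N)) => c i /=; case: ifP => _ /(congr1 fst) /= e1.
  by left; exists c; rewrite conjgE e1 mulKg.
by right; exists c^-1; rewrite conjgE invgK mulgA -e1 mulgK supp_ret.
Qed.

Lemma rootmap0_cinto (P : pred X) r : P x -> cinto P (rootmap0 r) -> cinto P r.
Proof.
move=> Px [h]; move e0: (_ ^ h) => g Pg.
have e : rootmap0 r * h = h * g by rewrite -e0 conjgE mulVKg.
have V1 : V (1, 0%N) by [].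
have Vh : V (fact a b h^-1 (1, 0%N)) by apply: (factV act).
have wP w d i : all (fun l => P l.1) w -> supp P d -> supp P (wact a b w (d, i)).1.
  elim: w => //= -[y c] w IH /andP[/= Py Pw] Pd; have := IH Pw Pd.
  case: (wact a b w (d, i)) => f j; rewrite /sact /a /b /=.
  by case: c; do 2?case: ifP => //= _; rewrite // => Pf; rewrite suppM // ?suppV // supp_gen.
(* With [(d, i)] the image of [(1, 0)] under [h^-1], this yields [d * r = u * d], where [u] is the
   effect of [g] on the first coordinate and uses only letters of [P]. *)
have := congr1 (fun g => fact a b g (fact a b h^-1 (1, 0%N))) e.
rewrite /= !(factM act) // (factKV act) // fact_root0 // /B /= mulg1.
move=> /(congr1 (fact a b h^-1)); rewrite (factVK act); last exact: (factV act).
rewrite (factR h^-1 0 r) => e2; move: e2 Vh.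
case: (fact a b h^-1 (1, 0%N)) => d i /=; rewrite (factR g i d).
have := wP _ 1 i (supp_letters Pg) (supp1 P); rewrite -/(fact a b g (1, i)).
case: (fact a b g (1, i)) => u j /= Pu /(congr1 fst) /= e2 _.
by exists d^-1; rewrite conjgE invgK mulgA e2 mulgK.
Qed.
End Root.

Section RootTwist.
Variables (X : choiceType) (x t : X) (p : nat) (q : int).
Hypotheses (p_gt0 : (0 < p)%N) (xt : x != t).

(** Magnus' substitution: the exponent of [x] in the image is [p] times that of [x] minus [q] times
    that of [t], which a suitable choice of [p] and [q] makes zero. *)
Definition rootmap : freeg X -> freeg X := lift (fun y =>
  if y == x then gen x ^+ p else if y == t then gen t * gpow (gen x) (- q)%R else gen y).
HB.instance Definition _ := UMagmaMorphism.on rootmap.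

(** Undoing the twist of [t] reduces every statement to the adjunction of a root. *)
Let untwist : freeg X -> freeg X :=
  lift (fun y => if y == t then gen t * gpow (gen x) q else gen y).
HB.instance Definition _ := UMagmaMorphism.on untwist.

Let untwist_rootmap g : untwist (rootmap g) = rootmap0 x p g.
Proof.
move: g; apply: (@eq_hom _ _ (untwist \o rootmap)) => y.
have ux : untwist (gen x) = gen x by rewrite /untwist lift_gen (negbTE xt).
rewrite /= /rootmap /rootmap0 !lift_gen; case: ifP => [_|nx].
  by rewrite gmulfXn /= ux.
case: ifP => [/eqP ->|nt]; last by rewrite /untwist lift_gen nt.
rewrite gmulfM gmulf_gpow /= ux /untwist lift_gen eqxx gpowN mulgK //.
Qed.

Lemma rootmap_inj g : rootmap g = 1 -> g = 1.
Proof. by move=> g1; apply: (rootmap0_inj p_gt0 (x := x)); rewrite -untwist_rootmap g1. Qed.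

Lemma rootmap_conj r s h : rootmap r ^ h = rootmap s ->
  (exists c, r ^ c = s) \/ cinto (pred1 x) s.
Proof.
move=> rs; apply: (rootmap0_conj p_gt0 (x := x) (h := untwist h)).
by rewrite -!untwist_rootmap -rs gmulfJ.
Qed.

Lemma rootmap_cinto (P : pred X) r : P x -> cinto P (rootmap r) -> cinto P r.
Proof.
move=> Px [h Ph]; apply: (rootmap0_cinto p_gt0 Px); exists (untwist h).
rewrite -untwist_rootmap -gmulfJ; apply: supp_hom Ph => y Py.
rewrite /= /untwist lift_gen; case: eqP Py => [<- Py|_ Py]; last exact: supp_gen.
by apply: suppM; [|apply: supp_gpow]; apply: supp_gen.
Qed.
End RootTwist.

(** * Extensions by the integers *)

Section SemiDirect.
Variables (K : groupType) (tau : zact K).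

(* [(n, k)] stands for [z ^ n * k], where [k ^ z = tau 1 k]. *)
Definition sdp of zact K : Type := (int * K)%type.
Local Notation S := (sdp tau).
HB.instance Definition _ := Choice.on S.

Definition sdp_one : S := (0%R, 1).
Definition sdp_mul (u v : S) : S := ((u.1 + v.1)%R, tau v.1 u.2 * v.2).
Definition sdp_inv (u : S) : S := ((- u.1)%R, tau (- u.1)%R u.2^-1).

Lemma sdp_mulA : associative sdp_mul.
Proof.
move=> [m k] [n l] [o j]; rewrite /sdp_mul /= GRing.addrA zfunM -mulgA -zfunD.
by rewrite [(n + o)%R]GRing.addrC.
Qed.
Lemma sdp_mul1 : left_id sdp_one sdp_mul.
Proof. by move=> [m k]; rewrite /sdp_mul /= GRing.add0r zfun1 mul1g. Qed.
Lemma sdp_mulr1 : right_id sdp_one sdp_mul.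
Proof. by move=> [m k]; rewrite /sdp_mul /= GRing.addr0 zfun0 mulg1. Qed.
Lemma sdp_mulV : left_inverse sdp_one sdp_inv sdp_mul.
Proof. by move=> [m k]; rewrite /sdp_mul /= GRing.addNr zfunVK mulVg. Qed.
Lemma sdp_mulrV : right_inverse sdp_one sdp_inv sdp_mul.
Proof. by move=> [m k]; rewrite /sdp_mul /= GRing.subrr -zfunM mulgV zfun1. Qed.

HB.instance Definition _ :=
  isGroup.Build S sdp_mulA sdp_mul1 sdp_mulr1 sdp_mulV sdp_mulrV.

Lemma sdpM (u v : S) : u * v = ((u.1 + v.1)%R, tau v.1 u.2 * v.2). Proof. by []. Qed.
Lemma sdpV (u : S) : u^-1 = ((- u.1)%R, tau (- u.1)%R u.2^-1). Proof. by []. Qed.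

Lemma sdpJ k (u : S) : ((0%R, k) : S) ^ u = (0%R, tau u.1 k ^ u.2).
Proof.
rewrite !conjgE !sdpM sdpV /= GRing.add0r GRing.addNr -zfunD GRing.subrr.
by rewrite zfun0.
Qed.

(** Conjugation in the extension acts on the kernel by translations and inner automorphisms, so a
    single relator there becomes its whole orbit in [K]. *)
Lemma sdp_nclos (G : groupType) (f : {hom G -> S}) (A : G -> Prop) r g :
  (forall x, A x -> exists2 k, f x = (0%R, k) & nclos (orbit_of tau r) k) ->
  nclos A g -> exists2 k, f g = (0%R, k) & nclos (orbit_of tau r) k.
Proof.
move=> fA /(_ (fun g => exists2 k, f g = (0%R, k) & nclos (orbit_of tau r) k)).
apply=> //; split=> [|x y [k fx Nk] [l fy Nl]|x [k fx Nk]|x y [k fx Nk]].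
- by exists 1; [rewrite gmulf1 | apply: (normal1 (nclos_normal _))].
- exists (k * l); last exact: (normalM (nclos_normal _)).
  by rewrite gmulfM fx fy sdpM /= GRing.addr0 zfun0.
- exists k^-1; last exact: (normalV (nclos_normal _)).
  by rewrite gmulfV fx sdpV /= zfun0.
- exists (tau (f y).1 k ^ (f y).2); first by rewrite gmulfJ fx sdpJ.
  by apply: nclosJ; apply: nclos_orbit.
Qed.
End SemiDirect.

Lemma size_hom (X Y : choiceType) (f : {hom freeg X -> freeg Y}) (A : pred X) g :
  (forall x, size (fgval (f (gen x))) <= A x)%N ->
  (size (fgval (f g)) <= count (fun l => A l.1) (fgval g))%N.
Proof.
move=> fA; rewrite -{1}[g]wvalK; elim: (fgval g) => [|l w IH] /=; first by rewrite gmulf1.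
rewrite gmulfM (leq_trans (size_fgM _ _)) // leq_add // sgenE.
by case: ifP => _; rewrite ?gmulfV ?size_fgV; apply: fA.
Qed.

(** Letters sent to pure powers of the stable letter cost nothing; this is the source of the
    decrease in Magnus' induction. *)
Lemma size_hom_sdp (X Y : choiceType) (tau : zact (freeg Y)) (f : {hom freeg X -> sdp tau})
    (A : pred X) g :
  (forall n k, size (fgval (tau n k)) <= size (fgval k))%N ->
  (forall x, size (fgval (f (gen x)).2) <= A x)%N ->
  (size (fgval (f g).2) <= count (fun l => A l.1) (fgval g))%N.
Proof.
move=> tauA fA; rewrite -{1}[g]wvalK; elim: (fgval g) => [|l w IH] /=; first by rewrite gmulf1.
rewrite gmulfM sdpM /= (leq_trans (size_fgM _ _)) // leq_add // (leq_trans (tauA _ _)) // sgenE.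
by case: ifP => _ //; rewrite gmulfV sdpV /= (leq_trans (tauA _ _)) // size_fgV.
Qed.

Section Shift.
Variable X : choiceType.
Implicit Types (k : freeg (X * int)%type).

Definition shiftf (n : int) : freeg (X * int)%type -> freeg (X * int)%type :=
  lift (fun z => gen (z.1, (z.2 + n)%R)).

Lemma shiftf_gen n z : shiftf n (gen z) = gen (z.1, (z.2 + n)%R).
Proof. exact: lift_gen. Qed.

Lemma shiftfM n : {morph shiftf n : x y / x * y}. Proof. exact: liftM. Qed.
Lemma shiftfV n : {morph shiftf n : x / x^-1}. Proof. exact: liftV. Qed.

Lemma shiftf0 k : shiftf 0%R k = k.
Proof.
elim/freeg_ind: k => // -[y j] k IH; rewrite shiftfM ?shiftfV shiftf_gen /= IH;
by rewrite GRing.addr0.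
Qed.

Lemma shiftfD m n k : shiftf (m + n)%R k = shiftf m (shiftf n k).
Proof.
elim/freeg_ind: k => // -[y j] k IH; rewrite !shiftfM ?shiftfV !shiftf_gen /= IH;
by rewrite -GRing.addrA [(n + m)%R]GRing.addrC.
Qed.

Definition shift : zact (freeg (X * int)%type) := ZAct shiftfM shiftf0 shiftfD.

Lemma shift_gen n z : shift n (gen z) = gen (z.1, (z.2 + n)%R).
Proof. exact: lift_gen. Qed.

Lemma size_shift n k : (size (fgval (shift n k)) <= size (fgval k))%N.
Proof.
rewrite (leq_trans (size_hom (f := zfun shift n) (A := predT) _ _)) ?count_predT //.
Qed.
End Shift.

Section Base.
Variables (X : choiceType) (b : X) (tau : zact (freeg (X * int)%type)).

(** Reidemeister-Schreier rewriting for the kernel of the exponent of [b], presented as a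
    homomorphism to an extension by the integers. *)
Definition base : freeg X -> sdp tau :=
  lift (fun y => if y == b then (1%R, 1) : sdp tau else (0%R, gen (y, 0%R))).
HB.instance Definition _ := UMagmaMorphism.on base.

Lemma baseM g h : base (g * h) = base g * base h. Proof. exact: liftM. Qed.
Lemma baseV g : base g^-1 = (base g)^-1. Proof. exact: liftV. Qed.
Lemma base_gen y : base (gen y) = if y == b then (1%R, 1) else (0%R, gen (y, 0%R)).
Proof. exact: lift_gen. Qed.

Lemma base_fst g : (base g).1 = expo b g.
Proof.
elim/freeg_ind: g => // y g IH; rewrite baseM ?baseV base_gen expoM ?expoV expo_gen sdpM IH;
by case: ifP.
Qed.

Section Unbase.
Variables (M : freeg X -> Prop) (nM : normal_pred M)
  (kap : {hom freeg (X * int)%type -> freeg X}).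
Hypothesis kap_gen : forall y, y != b -> kap (gen (y, 0%R)) = gen y.
Hypothesis kap_tau : forall n k, eqmod M (kap (tau n k)) (kap k ^ gpow (gen b) n).

(** The map [kap] has to turn translation into conjugation by [b] only modulo [M]: the trivial [M]
    serves free groups, the normal closure of the relator serves G. *)
Lemma unbase g : eqmod M (gpow (gen b) (base g).1 * kap (base g).2) g.
Proof.
pose E (u : sdp tau) := gpow (gen b) u.1 * kap u.2.
have EM u v : eqmod M (E (u * v)) (E u * E v).
  rewrite /E sdpM /= gpowD gmulfM !mulgA.
  have := eqmodM nM (eqmod_refl nM (gpow (gen b) u.1 * gpow (gen b) v.1))
    (eqmodM nM (kap_tau v.1 u.2) (eqmod_refl nM (kap v.2))).
  by gsolve.
have E1 : E 1 = 1 by rewrite /E gmulf1 mulg1.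
have Egen y : E (base (gen y)) = gen y.
  rewrite base_gen; case: ifP => [/eqP ->|nb]; first by rewrite /E gmulf1 mulg1.
  by rewrite /E /= mul1g kap_gen ?nb.
have Einv u : eqmod M (E u^-1) (E u)^-1.
  have h : eqmod M (E u^-1 * E u) 1 by apply: eqmod_sym; rewrite // -E1 -{1}(mulVg u); apply: EM.
  by have := eqmodM nM h (eqmod_refl nM (E u)^-1); rewrite mulgK mul1g.
elim/freeg_ind: g => [|y g IH|y g IH]; first by apply: (eqmod_eq nM); exact: E1.
- rewrite baseM; apply: (eqmod_trans nM) (EM _ _) _; rewrite Egen.
  exact: (eqmodM nM (eqmod_refl nM _) IH).
- rewrite baseM baseV; apply: (eqmod_trans nM) (EM _ _) _; apply: (eqmodM nM) IH.
  by apply: (eqmod_trans nM) (Einv _) _; rewrite Egen; apply: eqmod_refl.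
Qed.
End Unbase.
End Base.

Lemma normal_eq1 (G : groupType) : normal_pred (eq (1 : G)).
Proof. by split=> // [_ _ <- <-|_ <-|_ y <-]; rewrite ?mulg1 ?invg1 ?conj1g. Qed.

(** * The kernel of an exponent *)

Lemma shift_window (X : choiceType) (t : X) :
  let lev (z : X * int) := if z.1 == t then Some z.2 else None in
  [/\ (forall y j, lev y = Some j ->
        supp (fun z => lev z == Some (j + 1)%R) (shift X 1%R (gen y))),
      (forall y, lev y = None ->
        supp (fun z => (lev z == None) || (lev z == Some 0%R)) (shift X 1%R (gen y))),
      (forall y j, lev y = Some j ->
        supp (fun z => lev z == Some (j - 1)%R) (shift X (-1)%R (gen y)))
    & (forall y, lev y = None ->
        supp (fun z => (lev z == None) || (lev z == Some (-1)%R)) (shift X (-1)%R (gen y)))].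
Proof.
split=> [[y i] j|[y i]|[y i] j|[y i]] /=.
- by case: ifP => //= yt [<-]; rewrite shift_gen; apply: supp_gen; rewrite /= yt.
- by case: ifP => //= yt _; rewrite shift_gen; apply: supp_gen; rewrite /= yt.
- by case: ifP => //= yt [<-]; rewrite shift_gen; apply: supp_gen; rewrite /= yt.
- by case: ifP => //= yt _; rewrite shift_gen; apply: supp_gen; rewrite /= yt.
Qed.

Lemma supp_shift (X : choiceType) (P : pred X) n k :
  supp (fun z : X * int => P z.1) k -> supp (fun z => P z.1) (shift X n k).
Proof. by apply: supp_hom => z Pz; rewrite /= shift_gen supp_gen. Qed.

Lemma base_gpow (X : choiceType) (x : X) tau n : base x tau (gpow (gen x) n) = (n, 1).
Proof.
rewrite gmulf_gpow /= base_gen eqxx; elim: n => [|n IH|n IH] //.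
  by rewrite -addn1 PoszD gpowS IH sdpM /= zfun1 mulg1.
by rewrite -addn1 PoszD GRing.opprD gpowB IH sdpM /= !invg1 !zfun1 mulg1.
Qed.

(** * Magnus' rewriting and its inverse *)

Section MagnusStep.
Variables (X : choiceType) (x t : X) (p : nat) (q : int).
Hypotheses (p_gt0 : (0 < p)%N) (xt : x != t).

Definition unshift : freeg (X * int)%type -> freeg X :=
  lift (fun z => gen z.1 ^ gpow (gen x) z.2).
HB.instance Definition _ := UMagmaMorphism.on unshift.

Lemma unshiftM : {morph unshift : g h / g * h}. Proof. exact: liftM. Qed.
Lemma unshiftV : {morph unshift : g / g^-1}. Proof. exact: liftV. Qed.
Lemma unshiftJ : {morph unshift : g h / g ^ h}. Proof. exact: gmulfJ. Qed.
Lemma unshift_gen z : unshift (gen z) = gen z.1 ^ gpow (gen x) z.2.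
Proof. exact: lift_gen. Qed.

Lemma unshift_shift n k : unshift (shift X n k) = unshift k ^ gpow (gen x) n.
Proof.
elim/freeg_ind: k => [|z k IH|z k IH]; first by rewrite zfun1 /= conj1g.
- rewrite zfunM shift_gen (unshiftM (gen (z.1, (z.2 + n)%R))) (unshiftM (gen z)) conjMg IH.
  by rewrite !unshift_gen /= gpowD conjgM.
- rewrite zfunM zfunV shift_gen (unshiftM (gen (z.1, (z.2 + n)%R))^-1) (unshiftM (gen z)^-1) conjMg IH.
  by rewrite !unshiftV conjVg !unshift_gen /= gpowD conjgM.
Qed.

Definition magnus (g : freeg X) : sdp (shift X) := base x (shift X) (rootmap x t p q g).

Lemma magnusM : {morph magnus : g h / g * h}.
Proof. by move=> g h; rewrite /magnus gmulfM baseM. Qed.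
HB.instance Definition _ := isUMagmaMorphism.Build (freeg X) (sdp (shift X)) magnus (erefl, magnusM).
Lemma magnusV : {morph magnus : g / g^-1}. Proof. exact: gmulfV. Qed.

Lemma rootmap_gen y : rootmap x t p q (gen y) =
  if y == x then gen x ^+ p else if y == t then gen t * gpow (gen x) (- q)%R else gen y.
Proof. exact: lift_gen. Qed.

Lemma magnus_gen y : magnus (gen y) = if y == x then ((p%:Z)%R, 1) else
  if y == t then ((- q)%R, gen (t, (- q)%R)) else (0%R, gen (y, 0%R)).
Proof.
rewrite /magnus rootmap_gen; case: ifP => [_|yx]; first exact: (base_gpow x _ p).
case: ifP => [_|yt]; last by rewrite base_gen yx.
rewrite baseM base_gpow base_gen eq_sym (negbTE xt) sdpM /= shift_gen /= mulg1.
by rewrite !GRing.add0r.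
Qed.

Lemma magnus_fst g : (magnus g).1 = (p%:Z * expo x g - q * expo t g)%R.
Proof.
have gE y : (magnus (gen y)).1 = (p%:Z * expo x (gen y) - q * expo t (gen y))%R.
  rewrite magnus_gen !expo_gen; case: (y =P x) => [->|_] /=.
    by rewrite (negbTE xt); lia.
  by case: eqP => _ /=; lia.
elim/freeg_ind: g => [|y g IH|y g IH].
- by rewrite /= !GRing.mulr0.
- by rewrite magnusM sdpM /= IH gE !expoM; lia.
- by rewrite magnusM magnusV sdpM sdpV /= IH gE !expoM !expoV; lia.
Qed.

Lemma unshift_magnus g : (magnus g).1 = 0%R -> unshift (magnus g).2 = rootmap x t p q g.
Proof.
move=> g0; have := @unbase X x (shift X) _ (normal_eq1 _) unshift _ _ (rootmap x t p q g).
rewrite -/(magnus g) g0 mul1g => h; apply: (mulgI (unshift (magnus g).2)^-1).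
rewrite mulVg; apply: h => [y _|n k]; first by rewrite /= unshift_gen conjg1.
by rewrite /= unshift_shift; apply: (eqmod_refl (normal_eq1 _)).
Qed.

Lemma magnus_inj g : magnus g = 1 -> g = 1.
Proof.
move=> g1; apply: (rootmap_inj (q := q) p_gt0 xt).
by rewrite -unshift_magnus g1.
Qed.

(** Each [x] becomes a pure power of the stable letter and every other letter becomes a single
    letter. *)
Lemma size_magnus g : x \in [seq l.1 | l <- fgval g] ->
  (size (fgval (magnus g).2) < size (fgval g))%N.
Proof.
move=> xg; have := size_hom_sdp (f := magnus) (A := predC1 x) g (@size_shift X).
move=> /(_ (fun y => _)) h; apply: (leq_ltn_trans (h _)) => [y|].
  by rewrite /= magnus_gen; case: ifP => //= _; case: ifP.
rewrite -(count_predC (fun l => l.1 == x) (fgval g)) -addn1 addnC leq_add2r.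
by rewrite -has_count; apply/hasP; case/mapP: xg => l lg ->; exists l.
Qed.

Lemma magnus_nclos r g k : magnus r = (0%R, k) -> nclos1 r g ->
  exists2 l, magnus g = (0%R, l) & nclos (orbit_of (shift X) k) l.
Proof.
move=> rk; apply: sdp_nclos => _ <-; exists k => //; apply: nclos_in.
by exists 0%R; rewrite zfun0.
Qed.

Lemma magnus_cinto (P : pred X) (Q : pred (X * int)%type) r k i :
  magnus r = (0%R, k) -> P x -> (forall z, Q z -> P z.1) ->
  cinto Q (shift X i k) -> cinto P r.
Proof.
move=> rk Px QP [h Qh]; apply: (rootmap_cinto p_gt0 xt (q := q)) => //.
have e : unshift k = rootmap x t p q r by rewrite -unshift_magnus rk.
rewrite -e; exists (gpow (gen x) i * unshift h).
rewrite conjgM -unshift_shift -unshiftJ; apply: supp_hom Qh => z /QP Pz.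
by rewrite /= unshift_gen suppJ ?supp_gen // supp_gpow ?supp_gen.
Qed.

Lemma magnus_supp (P : pred X) g :
  supp P g -> supp (fun z => P z.1) (magnus g).2.
Proof.
apply: (supp_ind (C := fun g => supp (fun z => P z.1) (magnus g).2)).
- exact: supp1.
- by move=> {}g h Pg Ph; rewrite magnusM sdpM /= suppM // supp_shift.
- by move=> {}g Pg; rewrite magnusV sdpV /= supp_shift // suppV.
- move=> y Py; rewrite magnus_gen; case: ifP => _; first exact: supp1.
  by case: eqP => [<-|_]; apply: supp_gen.
Qed.

(** Without twist, only occurrences of [x] change the level. *)
Lemma magnus_supp0 g : q = 0%R -> supp (predC1 x) g ->
  supp (fun z => (z.1 != x) && (z.2 == 0%R)) (magnus g).2.
Proof.
move=> q0 Pg; suff: (magnus g).1 = 0%R /\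
    supp (fun z => (z.1 != x) && (z.2 == 0%R)) (magnus g).2 by case.
move: g Pg; apply: supp_ind.
- by split=> //; exact: supp1.
- by move=> g h [g1 Pg] [h1 Ph]; rewrite magnusM sdpM /= g1 h1 zfun0 suppM.
- by move=> g [g1 Pg]; rewrite magnusV sdpV /= g1 GRing.oppr0 zfun0 suppV.
- move=> y /= yx; rewrite magnus_gen (negbTE yx) q0; case: eqP => [<-|_];
    by split=> //; apply: supp_gen; rewrite /= yx.
Qed.
End MagnusStep.

(** * The Freiheitssatz *)

(** Applying the retraction to the conjugacy conjugates [ret P r] to the same element as [r]. *)
Lemma conj_ret (X : choiceType) (P : pred X) (r : freeg X) :
  cinto P r -> exists h, r ^ h = ret P r.
Proof.
case=> h Ph; exists (h * (ret P h)^-1); rewrite conjgM -(suppP Ph) retJ.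
by rewrite conjgK.
Qed.

(* A conjugate of [r] avoiding a letter is conjugate to the retract of [r] killing
   that letter, so letters can be removed one at a time. *)
Lemma freiheit_letters (X : choiceType) (r : freeg X) :
  (forall c g, ~ cinto (predC1 c) r -> supp (predC1 c) g -> nclos1 r g -> g = 1) ->
  freiheit r.
Proof.
move=> F1 P nP g Pg Ng.
suff [c Pc nc] : exists2 c, ~~ P c & ~ cinto (predC1 c) r.
  apply: (F1 c) => //; apply: sub_supp Pg => y /=.
  by apply: contraTN => /eqP ->.
apply: contrapT => no; apply: nP.
have all_c c : ~~ P c -> cinto (predC1 c) r.
  by move=> Pc; apply: contrapT => nc; apply: no; exists c.
have rets s : all (predC P) s -> exists h, r ^ h = ret (fun y => y \notin s) r.
  elim: s => [_|c s IH /= /andP[/all_c/conj_ret[h rh] /IH[k rk]]].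
    by exists 1; rewrite conjg1; apply/esym/suppP/supp_all/allP.
  exists (k * ret (fun y => y \notin s) h); rewrite conjgM rk -retJ rh.
  apply: (@eq_hom _ _ (ret _ \o ret _) (ret _) _ r) => y.
  rewrite /= !ret_gen inE negb_or /=; case: eqP => _ /=; first by rewrite ret1.
  by rewrite ret_gen.
have [|h rh] := rets [seq y <- [seq l.1 | l <- fgval r] | ~~ P y].
  by apply/allP => y; rewrite mem_filter => /andP[].
exists h; rewrite rh.
apply: (supp_hom (P := fun y => y \in [seq l.1 | l <- fgval r])).
  move=> y yr; rewrite /= ret_gen mem_filter yr andbT negbK.
  by case: ifP => [/supp_gen//|_]; exact: supp1.
by apply: supp_all; apply/allP => l lr; apply: map_f.
Qed.

(** Take [p] to be the absolute value of [b] and [q] to be [a] up to sign; when [a] is zero, [p = 1]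
    and [q = 0] work. *)
Lemma pick_exponents (a b : int) : (a == 0%R) || (b != 0%R) ->
  exists (p : nat) (q : int), (0 < p)%N /\ (p%:Z * a = q * b)%R.
Proof.
case: (a =P 0%R) => [->|_ /= b0]; first by exists 1%N, 0%R; rewrite GRing.mulr0 GRing.mul0r.
exists (absz b); case: (boolP (0 < b)%R) => hb.
  exists a; split; first lia.
  by rewrite (_ : (absz b)%:Z = b)%R; [rewrite GRing.mulrC | lia].
exists (- a)%R; split; first lia.
by rewrite (_ : (absz b)%:Z = - b)%R; [rewrite !GRing.mulNr GRing.mulrC | lia].
Qed.

Lemma rootmap_id (X : choiceType) (x t : X) g : rootmap x t 1 0%R g = g.
Proof.
apply: (@eq_hom _ _ (rootmap x t 1 0%R) idfun) => y; rewrite /= rootmap_gen.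
by case: eqP => [->|_] //; case: eqP => [->|_] //; rewrite mulg1.
Qed.

Section MagnusWindow.
Variables (X : choiceType) (x t : X) (p : nat) (q : int) (r : freeg X).
Hypotheses (p_gt0 : (0 < p)%N) (xt : x != t).
Hypothesis pq : (p%:Z * expo x r = q * expo t r)%R.

Let lev (z : X * int) := if z.1 == t then Some z.2 else None.

Lemma magnus_kernel : magnus x t p q r = (0%R, (magnus x t p q r).2).
Proof. by rewrite [LHS]surjective_pairing magnus_fst // pq GRing.subrr. Qed.

(** An empty window contains no copy of [t], so mapping back would conjugate [r] away from [t]. *)
Lemma magnus_window0 i : ~ cinto (predC1 t) r ->
  ~ cinto (window lev 0 0) (shift X i (magnus x t p q r).2).
Proof.
move=> nt W0; apply: nt; apply: (magnus_cinto p_gt0 xt magnus_kernel _ _ W0) => //.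
move=> z; rewrite /window /lev /=; case: eqP => //= _; lia.
Qed.

Hypothesis xr : x \in [seq l.1 | l <- fgval r].
Hypothesis nt : ~ cinto (predC1 t) r.
Hypothesis IHr : forall k : freeg (X * int)%type,
  (size (fgval k) < size (fgval r))%N -> freiheit k.

Lemma magnus_freiheit i : freiheit (shift X i (magnus x t p q r).2).
Proof.
by apply: IHr; apply: leq_ltn_trans (size_shift _ _) _; apply: size_magnus.
Qed.

Lemma magnus_window g : nclos1 r g -> exists i h (l : nat) kg,
  let r' := shift X i (magnus x t p q r).2 ^ h in
  [/\ magnus x t p q g = (0%R, kg), freiheit r', ~ cinto (window lev 0 l) r',
    (forall u, supp (window lev 0 l.+1) u ->
       nclos (orbit_of (shift X) (magnus x t p q r).2) u -> nclos1 r' u)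
    & nclos (orbit_of (shift X) (magnus x t p q r).2) kg].
Proof.
move=> Ng; have [kg gk kgN] := magnus_nclos magnus_kernel Ng.
have [up up0 dn dn0] := shift_window t.
have [[i W0]|[l [i [h [Wr nW hW]]]]] := window_dichotomy up up0 dn dn0 magnus_freiheit.
  by case: (magnus_window0 nt W0).
exists i, h, l, kg; split=> //; first exact/freiheitJ/magnus_freiheit.
by have := nW 0%R; rewrite zfun0.
Qed.
End MagnusWindow.

(** Let [g] avoid the letter [c], and let [d] be another letter of [r]. If the exponents can be
    balanced, rewrite along [d] with [c] carrying the levels: [g] falls in the empty window.
    Otherwise [c] has exponent 0 in [r]; rewrite along [c] with [d] carrying the levels: [g] stays
    at level 0. *)
Lemma Freiheitssatz_size (n : nat) (X : choiceType) (r : freeg X) :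
  (size (fgval r) <= n)%N -> freiheit r.
Proof.
elim: n X r => [|n IH] X r.
  rewrite leqn0 size_eq0 => /eqP r0 P _ g _; rewrite (_ : r = 1); last exact: val_inj.
  exact: nclos1_1.
move=> rn; apply: freiheit_letters => c g nc Pg Ng.
(* If [c] is the only letter of [r], killing [c] kills [r] and fixes [g]. *)
have [/(supp_all (P := pred1 c)) rc|] := boolP (all (fun l => l.1 == c) (fgval r)).
  have := nclos1_hom (f := ret (predC1 c)) Ng; rewrite /= (suppP Pg).
  rewrite (hom_supp1 (f := ret (predC1 c)) _ rc); first exact: nclos1_1.
  by move=> y /eqP ->; rewrite /= ret_gen /= eqxx.
case/allPn => -[d bd] dr /= dc.
have cr : c \in [seq l.1 | l <- fgval r].
  apply: contrapT => /negP cr; apply: nc; exists 1; rewrite conjg1; apply: supp_all.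
  by apply/allP => l lr; apply: contraNN cr => /eqP <-; apply: map_f.
have {bd}dr : d \in [seq l.1 | l <- fgval r] by apply: (map_f fst dr).
have IHr k : (size (fgval k) < size (fgval r))%N -> freiheit k.
  by move=> kr; apply: IH; rewrite -ltnS (leq_trans kr).
have [|] := boolP ((expo d r == 0%R) || (expo c r != 0%R)).
  move=> /pick_exponents[p [q [p0 pq]]].
  have [i [h [l [kg [gk Fr' nW hW kgN]]]]] := magnus_window p0 dc pq dr nc (IHr _) Ng.
  apply: (magnus_inj p0 dc (q := q)); rewrite gk (_ : kg = 1) //.
  have Wk : supp (window (fun z => if z.1 == c then Some z.2 else None) 0 0) kg.
    have := magnus_supp p q dc Pg; rewrite gk; apply: sub_supp => -[y j] /= yc.
    by rewrite /window /= (negbTE yc).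
  apply: (Fr' _ nW) (hW _ _ kgN); first by apply: sub_window Wk; lia.
  by apply: sub_window Wk; lia.
rewrite negb_or negbK => /andP[d0 /eqP c0].
have cd : c != d by rewrite eq_sym.
(* The nonzero exponent of [d] survives conjugation. *)
have nd : ~ cinto (predC1 d) r.
  case=> h rh; case/eqP: d0; rewrite -(expoJ _ _ h).
  by apply: expo_supp0 rh => /=; rewrite eqxx.
have pq : (1%:Z * expo c r = 0 * expo d r)%R by rewrite c0 GRing.mulr0 GRing.mul0r.
have [i [h [l [kg [gk Fr' nW hW kgN]]]]] := magnus_window (ltn0Sn 0) cd pq cr nd (IHr _) Ng.
apply: (magnus_inj (ltn0Sn 0) cd (q := 0%R)); rewrite gk (_ : kg = 1) //.
pose Q (z : X * int) := (z.1 != c) && (z.2 == 0%R).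
have Qk : supp Q kg by have := magnus_supp0 1 cd (erefl 0%R) Pg; rewrite gk.
apply: (Fr' Q) => //; last first.
  by apply: hW => //; apply: sub_supp Qk => -[y j] /andP[/= _ /eqP ->]; rewrite /window; case: ifP.
(* A conjugate of the translate lying at level 0 without [c] would map back to a conjugate of [r]
   avoiding [c]. *)
move=> /cintoJ[k Qk']; apply: nc; exists (gpow (gen c) i * unshift c k).
have <- : unshift c (magnus c d 1 0 r).2 = r.
  by rewrite unshift_magnus ?rootmap_id // magnus_fst // pq GRing.subrr.
rewrite conjgM -unshift_shift -unshiftJ; apply: supp_hom Qk' => -[y j] /andP[/= yc /eqP ->].
by rewrite unshift_gen conjg1 supp_gen.
Qed.

Theorem Freiheitssatz (X : choiceType) (r : freeg X) : freiheit r.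
Proof. exact: Freiheitssatz_size (leqnn _). Qed.

(** * Magnus' theorem for free groups *)

Lemma nclos_expo (X : choiceType) (c : X) (d : int) (A : freeg X -> Prop) g :
  (forall x, A x -> (d %| expo c x)%Z) -> nclos A g -> (d %| expo c g)%Z.
Proof.
move=> Ad /(_ (fun g => (d %| expo c g)%Z)); apply=> //.
split=> [|x y hx hy|x hx|x y hx].
- exact: dvdz0.
- by rewrite expoM; apply: GRing.rpredD.
- by rewrite expoV GRing.rpredN.
- by rewrite expoJ.
Qed.

Lemma dvdz_anti (k l : int) : (k %| l)%Z -> (l %| k)%Z -> k = l \/ k = (- l)%R.
Proof.
move=> kl lk; have /eqP : absz k == absz l by rewrite eqn_dvd; apply/andP; split.
by lia.
Qed.

Definition conjpm (G : groupType) (r s : G) := exists h, r ^ h = s \/ r ^ h = s^-1.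

Lemma conjpmJ (G : groupType) (r s h : G) : conjpm (r ^ h) s -> conjpm r s.
Proof. by case=> k; rewrite -conjgM; exists (h * k). Qed.

Lemma conjpmJr (G : groupType) (r s h : G) : conjpm r (s ^ h) -> conjpm r s.
Proof. by case=> k [rk|rk]; exists (k * h^-1); rewrite conjgM rk -?conjVg conjgK; auto. Qed.

Section MagnusPair.
Variables (X : choiceType) (x t : X) (p : nat) (q : int) (r s : freeg X).
Hypotheses (p_gt0 : (0 < p)%N) (xt : x != t).
Hypothesis pq : (p%:Z * expo x r = q * expo t r)%R.
Hypothesis nt : ~ cinto (predC1 t) r.
Hypothesis IHr : forall k l : freeg (X * int)%type,
  (size (fgval k) < size (fgval r))%N -> nclos1 k l -> nclos1 l k -> conjpm k l.
Hypothesis xr : x \in [seq l.1 | l <- fgval r].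

Lemma rootmap_conjpm : conjpm (rootmap x t p q r) (rootmap x t p q s) -> conjpm r s.
Proof.
have nx : ~ cinto (pred1 x) r.
  by case=> h xh; apply: nt; exists h; apply: sub_supp xh => y /eqP ->.
(* The conjugacy is reversed so that the exceptional case of [rootmap_conj] concerns [r], where [nx]
   excludes it. *)
case=> h [rs|rs]; have := congr1 (fun g => g ^ h^-1) rs; rewrite conjgK => rs'.
  case: (rootmap_conj p_gt0 xt (esym rs')) => // -[c <-].
  by exists c^-1; left; rewrite conjgK.
have e : rootmap x t p q s^-1 ^ h^-1 = rootmap x t p q r by rewrite gmulfV.
case: (rootmap_conj p_gt0 xt e) => // -[c <-].
by exists c^-1; right; rewrite conjgK.
Qed.

(** After rewriting, [window_pair] replaces the two orbits by two single relators with the same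
    normal closure. The one coming from [r] is shorter than [r], so the induction hypothesis
    applies, and [unshift] and [rootmap_conjpm] carry the conjugacy back. *)
Lemma magnus_pair : nclos1 r s -> nclos1 s r -> conjpm r s.
Proof.
move=> Ns Nr; have rk := magnus_kernel p_gt0 xt pq.
have [ks sk Nks] := magnus_nclos rk Ns.
have [kr rk' Nkr] := magnus_nclos sk Nr.
move: rk Nks; rewrite rk' /= => rk Nks.
have [up up0 dn dn0] := shift_window t.
have [[[i Wi] _]|[i [j [h [k [N1 N2]]]]]] := window_pair up up0 dn dn0
    (fun i => @Freiheitssatz _ (shift X i kr)) (fun i => @Freiheitssatz _ (shift X i ks)) Nks Nkr.
  by case: (magnus_window0 (i := i) p_gt0 xt pq nt); rewrite rk'.
have kr_small : (size (fgval (shift X i kr)) < size (fgval r))%N.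
  apply: leq_ltn_trans (size_shift _ _) _.
  by have := size_magnus p q xt xr; rewrite rk'.
have /conjpmJr [h' krs] : conjpm (shift X i kr) (shift X j ks ^ k).
  apply: IHr kr_small _ _; first exact: (nclos1JK (z := h) N1).
  by rewrite -[shift X i kr](conjgK h); apply: nclosJ.
have unr : unshift x kr = rootmap x t p q r by rewrite -unshift_magnus rk'.
have uns : unshift x ks = rootmap x t p q s by rewrite -unshift_magnus sk.
apply: rootmap_conjpm; apply: (conjpmJ (h := gpow (gen x) i)); apply: (conjpmJr (h := gpow (gen x) j)).
rewrite -unr -uns -!unshift_shift; exists (unshift x h'); rewrite -unshiftJ.
by case: krs => ->; [left | right; rewrite unshiftV].
Qed.
End MagnusPair.

(** A letter of [r] that can be conjugated away is retracted, which shortens [r]. Once none can be,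
    any letter of [r] may carry the levels, and the two letters are exchanged when their exponents
    cannot be balanced. *)
Lemma Magnus_size (n : nat) (X : choiceType) (r s : freeg X) :
  (size (fgval r) <= n)%N -> nclos1 r s -> nclos1 s r -> conjpm r s.
Proof.
elim: n X r s => [|n IH] X r s.
  rewrite leqn0 size_eq0 => /eqP r0; rewrite (_ : r = 1); last exact: val_inj.
  by move=> /nclos1_1 -> _; exists 1; left; rewrite conjg1.
move=> rn Ns Nr.
have [[c cr /conj_ret[h rh]]|nc] :=
    pselect (exists2 c, c \in [seq l.1 | l <- fgval r] & cinto (predC1 c) r).
  apply: (conjpmJ (h := h)); apply: IH; last exact: nclosJ.
    rewrite -ltnS; apply: leq_trans rn; rewrite rh.
    apply: (leq_ltn_trans (size_hom (f := ret (predC1 c)) (A := predC1 c) _ _)) => [y|].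
      by rewrite -[UMagmaMorphism.sort _ _]/(ret _ _) ret_gen /=; case: eqP.
    rewrite -(count_predC (fun l => l.1 == c) (fgval r)) -addn1 addnC leq_add2r.
    by rewrite -has_count; apply/hasP; case/mapP: cr => l lr ->; exists l.
  exact: nclos1J.
have {}nc c : c \in [seq l.1 | l <- fgval r] -> ~ cinto (predC1 c) r.
  by move=> cr ic; apply: nc; exists c.
case Er : (fgval r) => [|[c bc] w].
  move: Ns; rewrite (_ : r = 1); last exact: val_inj.
  by move=> /nclos1_1 ->; exists 1; left; rewrite conjg1.
have cr : c \in [seq l.1 | l <- fgval r] by rewrite Er inE eqxx.
have [/(supp_all (P := pred1 c)) rc|] := boolP (all (fun l => l.1 == c) (fgval r)).
  (* If [r] is a power of [c], the Freiheitssatz for [s] makes [s] conjugate to a power of [c]; the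
     exponents then divide each other. *)
  have [h sc] : cinto (pred1 c) s.
    apply: contrapT => ns; have r1 := Freiheitssatz ns rc Nr.
    by rewrite r1 in Er.
  have kl : (expo c r %| expo c s)%Z by apply: nclos_expo Ns => _ <-.
  have lk : (expo c s %| expo c r)%Z by apply: nclos_expo Nr => _ <-.
  apply: (conjpmJr (h := h)); exists 1; rewrite conjg1 (supp_pred1 rc) (supp_pred1 sc) expoJ.
  by case: (dvdz_anti kl lk) => ->; [left | right; rewrite gpowN].
case/allPn => -[d bd] dr /= dc.
have {bd}dr : d \in [seq l.1 | l <- fgval r] by apply: (map_f fst dr).
have IHr (k l : freeg (X * int)%type) : (size (fgval k) < size (fgval r))%N ->
    nclos1 k l -> nclos1 l k -> conjpm k l.
  by move=> kr; apply: IH; rewrite -ltnS (leq_trans kr).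
have [|] := boolP ((expo d r == 0%R) || (expo c r != 0%R)).
  move=> /pick_exponents[p [q [p0 pq]]].
  exact: (magnus_pair p0 dc pq (nc _ cr)).
rewrite negb_or negbK => /andP[d0 /eqP c0]; have cd : c != d by rewrite eq_sym.
have pq : (1%:Z * expo c r = 0 * expo d r)%R by rewrite c0 GRing.mulr0 GRing.mul0r.
exact: (magnus_pair (ltn0Sn 0) cd pq (nc _ dr)).
Qed.

Theorem Magnus (X : choiceType) (r s : freeg X) : nclos1 r s -> nclos1 s r -> conjpm r s.
Proof. exact: Magnus_size (leqnn _). Qed.

(** * One relator [[a, b] w] *)

Section ZActOf.
Variables (K : groupType) (f g : K -> K).
Hypotheses (fM : {morph f : x y / x * y}) (gM : {morph g : x y / x * y}).
Hypotheses (fK : cancel f g) (gK : cancel g f).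

Definition iterz (n : int) : K -> K :=
  match n with Posz m => iter m f | Negz m => iter m.+1 g end.

Lemma iterzS n x : iterz (n + 1)%R x = f (iterz n x).
Proof.
case: n => [n|[|n]]; first by rewrite -PoszD addn1.
  by rewrite /= gK.
have -> : (Negz n.+1 + 1 = Negz n)%R by lia.
exact: (esym (gK _)).
Qed.

Lemma iterzB n x : iterz (n - 1)%R x = g (iterz n x).
Proof. by rewrite -{2}[n](GRing.subrK 1%R) iterzS fK. Qed.

Lemma iterzM n : {morph iterz n : x y / x * y}.
Proof.
elim: n => [|n IH|n IH] x y //.
  by rewrite -addn1 PoszD !iterzS IH fM.
by rewrite -addn1 PoszD GRing.opprD !iterzB IH gM.
Qed.

Lemma iterzD m n x : iterz (m + n)%R x = iterz m (iterz n x).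
Proof.
elim: m => [|m IH|m IH]; first by rewrite GRing.add0r.
  by rewrite -addn1 PoszD GRing.addrAC !iterzS IH.
by rewrite -addn1 PoszD GRing.opprD GRing.addrAC !iterzB IH.
Qed.

Definition zact_of : zact K := ZAct iterzM (fun x => erefl) iterzD.
End ZActOf.

Section CommutatorGroup.
Variables (X : choiceType) (a b : X) (w : freeg X).
Hypotheses (ab : a != b) (wab : supp (fun y => (y != a) && (y != b)) w).

Definition rho : freeg X := [~ gen a, gen b] * w.

Local Notation M := (nclos1 rho).
Let nM : normal_pred M := nclos_normal (eq rho).

Lemma expo_rho c : c = a \/ c = b -> expo c rho = 0%R.
Proof.
move=> cab; rewrite /rho expoM commgEl expoM expoV expoJ GRing.addNr GRing.add0r.
by apply: expo_supp0 wab; case: cab => ->; rewrite eqxx ?andbF.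
Qed.

Definition at_level (j : int) : freeg X -> freeg (X * int)%type := lift (fun y => gen (y, j)).
HB.instance Definition _ j := UMagmaMorphism.on (at_level j).
Lemma at_level_gen j y : at_level j (gen y) = gen (y, j). Proof. exact: lift_gen. Qed.

(** Conjugation by [b]: the relator says that [b^-1 a b = a w^-1], and the other letters go up one
    level. *)
Definition tauf : freeg (X * int)%type -> freeg (X * int)%type :=
  lift (fun z => if z.1 == a then gen z * (at_level 0%R w)^-1 else gen (z.1, (z.2 + 1)%R)).
HB.instance Definition _ := UMagmaMorphism.on tauf.
Definition taug : freeg (X * int)%type -> freeg (X * int)%type :=
  lift (fun z => if z.1 == a then gen z * at_level (-1)%R w else gen (z.1, (z.2 - 1)%R)).
HB.instance Definition _ := UMagmaMorphism.on taug.

Lemma tauf_gen z : tauf (gen z) =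
  if z.1 == a then gen z * (at_level 0%R w)^-1 else gen (z.1, (z.2 + 1)%R).
Proof. exact: lift_gen. Qed.
Lemma taug_gen z : taug (gen z) =
  if z.1 == a then gen z * at_level (-1)%R w else gen (z.1, (z.2 - 1)%R).
Proof. exact: lift_gen. Qed.

Lemma tauf_level j : tauf (at_level j w) = at_level (j + 1)%R w.
Proof.
apply: (@eq_hom_supp _ _ (tauf \o at_level j) (at_level (j + 1)%R) _ _ _ wab) => y /andP[ya _].
by rewrite /= !at_level_gen tauf_gen (negbTE ya).
Qed.
Lemma taug_level j : taug (at_level j w) = at_level (j - 1)%R w.
Proof.
apply: (@eq_hom_supp _ _ (taug \o at_level j) (at_level (j - 1)%R) _ _ _ wab) => y /andP[ya _].
by rewrite /= !at_level_gen taug_gen (negbTE ya).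
Qed.

Lemma taufK : cancel tauf taug.
Proof.
apply: (@eq_hom _ _ (taug \o tauf) idfun) => z /=; rewrite tauf_gen; case: ifP => za.
  by rewrite gmulfM gmulfV /= taug_level taug_gen za mulgK.
by rewrite taug_gen za /= GRing.addrK -surjective_pairing.
Qed.
Lemma taugK : cancel taug tauf.
Proof.
apply: (@eq_hom _ _ (tauf \o taug) idfun) => z /=; rewrite taug_gen; case: ifP => za.
  by rewrite gmulfM /= tauf_level tauf_gen za mulgVK.
by rewrite tauf_gen za /= GRing.subrK -surjective_pairing.
Qed.

Lemma taufM : {morph tauf : x y / x * y}. Proof. exact: liftM. Qed.
Lemma taugM : {morph taug : x y / x * y}. Proof. exact: liftM. Qed.

Definition tau : zact (freeg (X * int)%type) := zact_of taufM taugM taufK taugK.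

Lemma tau1 x : tau 1%R x = tauf x. Proof. by []. Qed.
Lemma tauN1 x : tau (-1)%R x = taug x. Proof. by []. Qed.

(** Every copy of [a] is sent to [a] itself, in accordance with [tauf], which does not change the
    index of such a copy. *)
Definition kap : freeg (X * int)%type -> freeg X :=
  lift (fun z => if z.1 == a then gen a else gen z.1 ^ gpow (gen b) z.2).
HB.instance Definition _ := UMagmaMorphism.on kap.
Lemma kapM : {morph kap : x y / x * y}. Proof. exact: liftM. Qed.
Lemma kapV : {morph kap : x / x^-1}. Proof. exact: liftV. Qed.
Lemma kapJ : {morph kap : x y / x ^ y}. Proof. exact: gmulfJ. Qed.
Lemma kap_gen z : kap (gen z) = if z.1 == a then gen a else gen z.1 ^ gpow (gen b) z.2.
Proof. exact: lift_gen. Qed.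

Lemma kap_level0 : kap (at_level 0%R w) = w.
Proof.
apply: (@eq_hom_supp _ _ (kap \o at_level 0%R) idfun _ _ _ wab) => y /andP[ya _].
by rewrite /= at_level_gen kap_gen (negbTE ya) conjg1.
Qed.

Lemma rho_conj : eqmod M (gen a * w^-1) (gen a ^ gen b).
Proof.
have := nclosJ w^-1 (@nclos1_in _ rho).
by rewrite /eqmod /rho commgEl; gsolve.
Qed.

Lemma kap_tau1 k : eqmod M (kap (tauf k)) (kap k ^ gen b).
Proof.
have hgen z : eqmod M (kap (tauf (gen z))) (kap (gen z) ^ gen b).
  rewrite tauf_gen kap_gen; case: ifP => za.
    by rewrite kapM kapV kap_level0 kap_gen za; apply: rho_conj.
  by rewrite kap_gen za /= gpowS conjgM; apply: eqmod_refl.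
elim/freeg_ind: k => [|z k IH|z k IH].
- by rewrite gmulf1 conj1g; apply: (eqmod_refl nM).
- by rewrite gmulfM (kapM (tauf _)) (kapM (gen z)) conjMg; apply: (eqmodM nM).
- rewrite gmulfM gmulfV (kapM (tauf _)^-1) (kapM (gen z)^-1) conjMg !kapV conjVg.
  by apply: (eqmodM nM) => //; apply: (eqmodV nM).
Qed.

Lemma kap_tau n k : eqmod M (kap (tau n k)) (kap k ^ gpow (gen b) n).
Proof.
elim: n k => [|n IH|n IH] k; first by rewrite zfun0 conjg1; apply: eqmod_refl.
  rewrite -addn1 PoszD GRing.addrC zfunD tau1 GRing.addrC gpowS conjgM.
  apply: (eqmod_trans nM) (kap_tau1 _) _.
  by apply: (eqmodJ nM) => //; apply: eqmod_refl.
rewrite -addn1 PoszD GRing.opprD GRing.addrC zfunD tauN1 GRing.addrC gpowB conjgM.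
(* A downward step is the upward congruence read at a preimage under [tauf], then conjugated by
   [b^-1]. *)
have h := kap_tau1 (taug (tau (- n%:Z)%R k)); rewrite taugK in h.
have := eqmodJ nM (eqmod_trans nM (eqmod_sym nM h) (IH k)) (eqmod_refl nM (gen b)^-1).
by rewrite conjgK.
Qed.

Lemma kap_base g : expo b g = 0%R -> eqmod M (kap (base b tau g).2) g.
Proof.
move=> g0; have := unbase nM (kap := kap) _ kap_tau g.
rewrite base_fst g0 mul1g; apply => y yb; rewrite /= kap_gen /=.
by case: eqP => [->//|_]; rewrite conjg1.
Qed.

Lemma base_w : base b tau w = (0%R, at_level 0%R w).
Proof.
suff: (base b tau w).1 = 0%R /\ (base b tau w).2 = at_level 0%R w.
  by case=> <- <-; apply: surjective_pairing.
move: w wab; apply: supp_ind => [//|g h [g1 g2] [h1 h2]|g [g1 g2]|y /andP[ya yb]].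
- by rewrite baseM sdpM /= g1 h1 g2 h2 zfun0 gmulfM.
- by rewrite baseV sdpV /= g1 g2 GRing.oppr0 zfun0 gmulfV.
- by rewrite base_gen (negbTE yb) at_level_gen.
Qed.

(** By the choice of [tauf], the rewriting factors through G. *)
Lemma base_rho : base b tau rho = 1.
Proof.
rewrite /rho baseM base_w commgEl baseM baseV.
have -> : base b tau (gen a ^ gen b) = base b tau (gen a) ^ base b tau (gen b) by exact: gmulfJ.
rewrite !base_gen eqxx (negbTE ab) sdpJ conjg1 sdpV !sdpM /= tau1 tauf_gen eqxx !zfun0.
by rewrite mulKg mulVg.
Qed.

Definition relpm (r s : freeg X) := exists h, eqmod M (r ^ h) s \/ eqmod M (r ^ h) s^-1.

Lemma relpm_conj r r' s s' g h : eqmod M (r ^ g) r' -> eqmod M (s ^ h) s' ->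
  relpm r' s' -> relpm r s.
Proof.
move=> rr ss [k rs]; exists (g * k * h^-1); rewrite !conjgM.
have hJ x y : eqmod M x y -> eqmod M (x ^ h^-1) (y ^ h^-1).
  by move=> xy; exact (eqmodJ nM xy (eqmod_refl nM h^-1)).
have {}rr : eqmod M ((r ^ g) ^ k) (r' ^ k) by exact (eqmodJ nM rr (eqmod_refl nM k)).
have {}ss : eqmod M (s' ^ h^-1) s.
  by have := hJ _ _ (eqmod_sym nM ss); rewrite conjgK.
case: rs => rs; [left | right].
  exact (eqmod_trans nM (hJ _ _ (eqmod_trans nM rr rs)) ss).
have := hJ _ _ (eqmod_trans nM rr rs); rewrite conjVg => rs'.
exact (eqmod_trans nM rs' (eqmodV nM ss)).
Qed.

(** Normal closures in G are pulled back to the free group, where the relator joins the generating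
    set. *)
Definition with_rho (r x : freeg X) := r = x \/ rho = x.

(** Here only the copies of [a] have no level; their translates involve [w] at level 0 going up and
    at level -1 going down. *)
Lemma tau_window :
  let lev (z : X * int) := if z.1 == a then None else Some z.2 in
  [/\ (forall y j, lev y = Some j ->
        supp (fun z => lev z == Some (j + 1)%R) (tau 1%R (gen y))),
      (forall y, lev y = None ->
        supp (fun z => (lev z == None) || (lev z == Some 0%R)) (tau 1%R (gen y))),
      (forall y j, lev y = Some j ->
        supp (fun z => lev z == Some (j - 1)%R) (tau (-1)%R (gen y)))
    & (forall y, lev y = None ->
        supp (fun z => (lev z == None) || (lev z == Some (-1)%R)) (tau (-1)%R (gen y)))].
Proof.
have lw (j : int) : supp (fun z : X * int => ((if z.1 == a then None else Some z.2) == None)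
    || ((if z.1 == a then None else Some z.2) == Some j)) (at_level j w).
  apply: supp_hom wab => y /andP[/negbTE ya _].
  by rewrite /= at_level_gen; apply: supp_gen; rewrite /= ya eqxx.
split=> [y j|y|y j|y] /=; rewrite ?tau1 ?tauN1 ?tauf_gen ?taug_gen; case: ifP => //= ya e.
- by case: e => <-; apply: supp_gen; rewrite /= ya.
- by apply: suppM; [apply: supp_gen; rewrite /= ya | apply: suppV].
- by case: e => <-; apply: supp_gen; rewrite /= ya.
- by apply: suppM => //; apply: supp_gen; rewrite /= ya.
Qed.

Lemma kap_tauJ r n h : expo b r = 0%R ->
  eqmod M (r ^ (gpow (gen b) n * kap h)) (kap (tau n (base b tau r).2 ^ h)).
Proof.
move=> r0; rewrite conjgM.
have -> : kap (tau n (base b tau r).2 ^ h) = kap (tau n (base b tau r).2) ^ kap h by exact: kapJ.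
apply: (eqmodJ nM _ (eqmod_refl nM (kap h))); apply: (eqmod_sym nM).
apply: (eqmod_trans nM (kap_tau _ _)).
exact (eqmodJ nM (kap_base r0) (eqmod_refl nM _)).
Qed.

Lemma expo_b_eq0 r s : expo b r = 0%R -> nclos (with_rho r) s -> expo b s = 0%R.
Proof.
move=> r0 Ns; apply/eqP; rewrite -dvd0z; apply: nclos_expo Ns => x [<-|<-].
  by rewrite r0.
by rewrite expo_rho ?dvd0z //; right.
Qed.

Lemma base_nclos r s : expo b r = 0%R -> nclos (with_rho r) s ->
  nclos (orbit_of tau (base b tau r).2) (base b tau s).2.
Proof.
move=> r0 Ns.
have [|k -> //] := @sdp_nclos _ tau _ (base b tau) (with_rho r) (base b tau r).2 s _ Ns.
move=> x [<-|<-].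
  exists (base b tau r).2; last by apply: nclos_in; exists 0%R; rewrite zfun0.
  by rewrite [LHS]surjective_pairing /= base_fst r0.
exists 1; last by apply: normal1; apply: nclos_normal.
by rewrite /= base_rho.
Qed.

(** The relator has exponent 0 in [a] and in [b], so these exponents are defined on G. *)
Lemma expo_eqmod c x y : c = a \/ c = b -> eqmod M x y -> expo c x = expo c y.
Proof.
move=> cab xy; have : (0 %| expo c (x^-1 * y))%Z.
  by apply: nclos_expo xy => _ <-; rewrite expo_rho.
by rewrite dvd0z expoM expoV => /eqP; lia.
Qed.

Lemma relpm_expo0 r s : expo b r = 0%R ->
  nclos (with_rho r) s -> nclos (with_rho s) r -> relpm r s.
Proof.
move=> r0 Ns Nr; have s0 := expo_b_eq0 r0 Ns.
have [up up0 dn dn0] := tau_window.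
have [[[i [h Wr]] [j [k Ws]]]|[i [j [h [k [N1 N2]]]]]] := window_pair up up0 dn dn0
    (fun i => @Freiheitssatz _ _) (fun i => @Freiheitssatz _ _)
    (base_nclos r0 Ns) (base_nclos s0 Nr); last first.
  apply: relpm_conj (kap_tauJ i h r0) (kap_tauJ j k s0) _.
  case: (Magnus N1 N2) => g rs; exists (kap g).
  rewrite -kapJ.
  by case: rs => ->; [left | right; rewrite kapV]; apply: eqmod_refl.
apply: relpm_conj (kap_tauJ i h r0) (kap_tauJ j k s0) _.
have := kap_tauJ i h r0; have := kap_tauJ j k s0.
(* In the empty window only copies of [a] remain, and [kap] makes the element a power of [a]. *)
have W0 u : supp (window (fun z : X * int => if z.1 == a then None else Some z.2) 0 0) u ->
    supp (pred1 a) (kap u).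
  apply: supp_hom => z; rewrite /window /= kap_gen.
  case: eqP => [_ _|_]; first by apply: supp_gen => /=.
  by lia.
move: Wr Ws => /W0/supp_pred1 -> /W0/supp_pred1 ->.
set l := expo _ _; set m := expo _ _.
move=> /(expo_eqmod (or_introl erefl)); rewrite expoJ expo_gpow expo_gen eqxx GRing.mulr1 => sm.
move=> /(expo_eqmod (or_introl erefl)); rewrite expoJ expo_gpow expo_gen eqxx GRing.mulr1 => rl.
have lm : (l %| m)%Z.
  rewrite -sm -rl; apply: nclos_expo Nr => x [<-|<-]; first exact: dvdzz.
  by rewrite expo_rho ?dvdz0 //; left.
have ml : (m %| l)%Z.
  rewrite -sm -rl; apply: nclos_expo Ns => x [<-|<-]; first exact: dvdzz.
  by rewrite expo_rho ?dvdz0 //; left.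
exists 1; rewrite conjg1; case: (dvdz_anti lm ml) => ->; [left | right; rewrite gpowN ?invgK];
 exact (eqmod_refl nM _).
Qed.

Lemma nclos_auto (f : {hom freeg X -> freeg X}) r s : f rho = rho ->
  nclos (with_rho r) s -> nclos (with_rho (f r)) (f s).
Proof.
move=> fr; apply: nclos_hom => x [<-|<-]; apply: nclos_in; first by left.
by right; rewrite fr.
Qed.

Lemma relpm_auto (f g : {hom freeg X -> freeg X}) r s : cancel f g -> g rho = rho ->
  relpm (f r) (f s) -> relpm r s.
Proof.
move=> fK gr [h rs].
have gM x y : eqmod M x y -> eqmod M (g x) (g y).
  rewrite /eqmod -gmulfV -gmulfM => /(nclos1_hom (f := g)); by rewrite gr.
exists (g h); case: rs => /gM; rewrite gmulfJ ?gmulfV !fK; auto.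
Qed.

(** * Automorphisms fixing the relator *)

Definition twist_a (n : int) : freeg X -> freeg X :=
  lift (fun y => if y == a then gpow (gen b) n * gen a else gen y).
HB.instance Definition _ n := UMagmaMorphism.on (twist_a n).
Definition twist_b (n : int) : freeg X -> freeg X :=
  lift (fun y => if y == b then gpow (gen a) n * gen b else gen y).
HB.instance Definition _ n := UMagmaMorphism.on (twist_b n).

Lemma twist_aM n : {morph twist_a n : x y / x * y}. Proof. exact: liftM. Qed.
Lemma twist_aV n : {morph twist_a n : x / x^-1}. Proof. exact: liftV. Qed.
Lemma twist_bM n : {morph twist_b n : x y / x * y}. Proof. exact: liftM. Qed.
Lemma twist_bV n : {morph twist_b n : x / x^-1}. Proof. exact: liftV. Qed.
Lemma twist_a_gen n y : twist_a n (gen y) = if y == a then gpow (gen b) n * gen a else gen y.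
Proof. exact: lift_gen. Qed.
Lemma twist_b_gen n y : twist_b n (gen y) = if y == b then gpow (gen a) n * gen b else gen y.
Proof. exact: lift_gen. Qed.
Lemma twist_a_gpow n m : twist_a n (gpow (gen b) m) = gpow (gen b) m.
Proof. by rewrite gmulf_gpow /= twist_a_gen eq_sym (negbTE ab). Qed.
Lemma twist_b_gpow n m : twist_b n (gpow (gen a) m) = gpow (gen a) m.
Proof. by rewrite gmulf_gpow /= twist_b_gen (negbTE ab). Qed.

Lemma twist_aK n : cancel (twist_a n) (twist_a (- n)%R).
Proof.
apply: (@eq_hom _ _ (twist_a (- n)%R \o twist_a n) idfun) => y /=.
rewrite twist_a_gen; case: (y =P a) => [->|/eqP/negbTE ya]; last by rewrite twist_a_gen ya.
by rewrite gmulfM /= twist_a_gpow twist_a_gen eqxx gpowN mulVKg.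
Qed.
Lemma twist_bK n : cancel (twist_b n) (twist_b (- n)%R).
Proof.
apply: (@eq_hom _ _ (twist_b (- n)%R \o twist_b n) idfun) => y /=.
rewrite twist_b_gen; case: (y =P b) => [->|/eqP/negbTE ya]; last by rewrite twist_b_gen ya.
by rewrite gmulfM /= twist_b_gpow twist_b_gen eqxx gpowN mulVKg.
Qed.

Lemma gpowC (G : groupType) (x : G) n : x * gpow x n = gpow x n * x.
Proof. by rewrite -gpowS GRing.addrC gpowD. Qed.

(** The new factor [b^n] commutes with [b], so it cancels in the commutator. *)
Lemma twist_a_rho n : twist_a n rho = rho.
Proof.
rewrite /rho gmulfM gmulfR /= !twist_a_gen eqxx eq_sym (negbTE ab); congr (_ * _).
  by rewrite !commgEl conjMg [gpow _ _ ^ _]conjgE -gpowC mulKg; gsolve.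
apply: (@eq_hom_supp _ _ (twist_a n) idfun _ _ _ wab) => y /andP[/negbTE ya _].
by rewrite /= twist_a_gen ya.
Qed.
(** Conjugating [a] by [a^n b] is the same as conjugating it by [b]. *)
Lemma twist_b_rho n : twist_b n rho = rho.
Proof.
rewrite /rho gmulfM gmulfR /= !twist_b_gen eqxx (negbTE ab); congr (_ * _).
  rewrite !commgEl conjgM; congr (_ * _ ^ _).
  by rewrite conjgE gpowC mulKg.
apply: (@eq_hom_supp _ _ (twist_b n) idfun _ _ _ wab) => y /andP[_ /negbTE yb].
by rewrite /= twist_b_gen yb.
Qed.

Let expo1 c : expo c (1 : freeg X) = 0%R. Proof. by []. Qed.
Let ba : (b == a) = false. Proof. by rewrite eq_sym (negbTE ab). Qed.

Lemma expo_twist_a n g : expo a (twist_a n g) = expo a g /\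
  expo b (twist_a n g) = (expo b g + n * expo a g)%R.
Proof.
have hgen y : expo a (twist_a n (gen y)) = expo a (gen y) /\
    expo b (twist_a n (gen y)) = (expo b (gen y) + n * expo a (gen y))%R.
  rewrite twist_a_gen; case: (y =P a) => [->|/eqP/negbTE ya].
    by rewrite !expoM !expo_gpow !expo_gen !eqxx ?(negbTE ab) ?ba; split; lia.
  by rewrite !expo_gen ya; split=> //; lia.
have : supp predT g by apply: supp_all; apply: all_predT.
move: g; apply: supp_ind => [|g h [ga gb] [ha hb]|g [ga gb]|y _ //].
- by split=> //; rewrite !expo1 GRing.mulr0.
- by rewrite twist_aM !expoM ga gb ha hb; split=> //; lia.
- by rewrite twist_aV !expoV ga gb; split=> //; lia.
Qed.

Lemma expo_twist_b n g : expo b (twist_b n g) = expo b g /\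
  expo a (twist_b n g) = (expo a g + n * expo b g)%R.
Proof.
have hgen y : expo b (twist_b n (gen y)) = expo b (gen y) /\
    expo a (twist_b n (gen y)) = (expo a (gen y) + n * expo b (gen y))%R.
  rewrite twist_b_gen; case: (y =P b) => [->|/eqP/negbTE ya].
    by rewrite !expoM !expo_gpow !expo_gen !eqxx ?(negbTE ab) ?ba; split; lia.
  by rewrite !expo_gen ya; split=> //; lia.
have : supp predT g by apply: supp_all; apply: all_predT.
move: g; apply: supp_ind => [|g h [ga gb] [ha hb]|g [ga gb]|y _ //].
- by split=> //; rewrite !expo1 GRing.mulr0.
- by rewrite twist_bM !expoM ga gb ha hb; split=> //; lia.
- by rewrite twist_bV !expoV ga gb; split=> //; lia.
Qed.

Lemma relpm_twist_a n r s :
  (nclos (with_rho (twist_a n r)) (twist_a n s) ->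
   nclos (with_rho (twist_a n s)) (twist_a n r) -> relpm (twist_a n r) (twist_a n s)) ->
  nclos (with_rho r) s -> nclos (with_rho s) r -> relpm r s.
Proof.
move=> H Ns Nr; apply: (relpm_auto (twist_aK n)); first exact: twist_a_rho.
by apply: H; apply: nclos_auto => //; apply: twist_a_rho.
Qed.

Lemma relpm_twist_b n r s :
  (nclos (with_rho (twist_b n r)) (twist_b n s) ->
   nclos (with_rho (twist_b n s)) (twist_b n r) -> relpm (twist_b n r) (twist_b n s)) ->
  nclos (with_rho r) s -> nclos (with_rho s) r -> relpm r s.
Proof.
move=> H Ns Nr; apply: (relpm_auto (twist_bK n)); first exact: twist_b_rho.
by apply: H; apply: nclos_auto => //; apply: twist_b_rho.
Qed.

(* Euclid's algorithm on the exponents of [a] and [b]: [twist_a] and [twist_b] act on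
   them by elementary matrices. *)
Theorem commutator_Magnus r s :
  nclos (with_rho r) s -> nclos (with_rho s) r -> relpm r s.
Proof.
have [n] := ubnP (absz (expo b r)); elim: n r s => // n IH r s hn.
have [r0|/eqP r0] := expo b r =P 0%R; first exact: relpm_expo0.
have e : (expo a r = (expo a r %/ expo b r)%Z * expo b r + (expo a r %% expo b r)%Z)%R.
  exact: divz_eq.
have h0 : (0 <= (expo a r %% expo b r)%Z)%R by apply: modz_ge0.
have h1 : ((expo a r %% expo b r)%Z < absz (expo b r))%R by apply: ltz_mod.
set q := (expo a r %/ expo b r)%Z in e *.
(* Write [(A, B)] for the exponents of [a] and [b] and [R] for the remainder of [A] by [B]. The four
   twists give [(R, B)], [(R, B + R)], [(-B, B + R)] and finally [(-B, R)]. *)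
apply: (relpm_twist_b (n := (- q)%R)); have [b1 a1] := expo_twist_b (- q)%R r.
set r1 := twist_b _ r in b1 a1 *; set s1 := twist_b _ s.
apply: (relpm_twist_a (n := 1%R)); have [a2 b2] := expo_twist_a 1%R r1.
set r2 := twist_a _ r1 in b2 a2 *; set s2 := twist_a _ s1.
apply: (relpm_twist_b (n := (-1)%R)); have [b3 a3] := expo_twist_b (-1)%R r2.
set r3 := twist_b _ r2 in b3 a3 *; set s3 := twist_b _ s2.
apply: (relpm_twist_a (n := 1%R)); have [a4 b4] := expo_twist_a 1%R r3.
apply: IH; rewrite b4; lia.
Qed.
End CommutatorGroup.

(** * Words and the presented group *)

Lemma ret_wval (X : choiceType) (P : pred X) w :
  ret P (wval w) = wval [seq l <- w | P l.1].
Proof.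
elim: w => [|l w IH] //=; rewrite retM IH sgenE.
have -> : ret P (if l.2 then (gen l.1)^-1 else gen l.1) = if P l.1 then sgen l else 1.
  by rewrite sgenE; case: l => x [] /=; rewrite ?retV ret_gen; case: ifP => //; rewrite invg1.
by case: ifP => //= _; rewrite mul1g.
Qed.

Section Words.
Variables (n : nat) (rels : seq word).

Lemma peq_ncl N w1 w2 : normal_pred N -> {in rels, forall r, N (wval r)} ->
  peq n rels w1 w2 -> eqmod N (wval w1) (wval w2).
Proof.
move=> nN Nr; elim=> {w1 w2} [w|w1 w2 _|w1 w2 w3 _ h1 _|p q x _|p q r /Nr rN].
- exact (eqmod_refl nN _).
- exact: (eqmod_sym nN).
- exact: (eqmod_trans nN h1).
- by rewrite !wval_cat /= mulg1 (sgenV x) mulgV mul1g; exact (eqmod_refl nN _).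
- rewrite !wval_cat; apply: (eqmodM nN (eqmod_refl nN _)).
  rewrite -[X in eqmod _ _ X]mul1g; apply: (eqmodM nN _ (eqmod_refl nN _)).
  exact/(eqmod1 nN).
Qed.

Lemma peq_cat2l p w1 w2 : peq n rels w1 w2 -> peq n rels (p ++ w1) (p ++ w2).
Proof.
elim=> {w1 w2} [w|w1 w2 _|w1 w2 w3 _ h1 _|p' q x xn|p' q r rr].
- exact: peq_refl.
- exact: peq_sym.
- exact: peq_trans.
- by rewrite catA (catA p p' q); apply: peq_cancel.
- by rewrite (catA p p' (r ++ q)) (catA p p' q); apply: peq_rel.
Qed.

Lemma peq_cat2r p w1 w2 : peq n rels w1 w2 -> peq n rels (w1 ++ p) (w2 ++ p).
Proof.
elim=> {w1 w2} [w|w1 w2 _|w1 w2 w3 _ h1 _|p' q x xn|p' q r rr].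
- exact: peq_refl.
- exact: peq_sym.
- exact: peq_trans.
- by rewrite -!catA; apply: peq_cancel.
- by rewrite -!catA; apply: peq_rel.
Qed.

Lemma peq_winvr w : isword n w -> peq n rels (w ++ winv w) [::].
Proof.
elim: w => [_|x w IH /= /andP[xn wn]]; first exact: peq_refl.
rewrite /winv /= rev_cons -cats1 catA.
apply: peq_trans (peq_cancel rels [::] [::] xn).
exact: (peq_cat2l [:: x] (peq_cat2r [:: linv x] (IH wn))).
Qed.

Lemma winvK : involutive winv. Proof. exact: (@sinvwK nat). Qed.

Lemma isword_winv w : isword n w -> isword n (winv w).
Proof. by rewrite /isword /winv all_rev all_map; apply: sub_all => -[]. Qed.

Lemma peq_winvl w : isword n w -> peq n rels (winv w ++ w) [::].
Proof. by move=> /isword_winv/peq_winvr; rewrite winvK. Qed.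

(** The free group is taken on all natural numbers; erasing returns to the alphabet of the
    presentation. *)
Definition erase (w : word) : word := [seq l <- w | l.1 < n].

Lemma isword_erase w : isword n (erase w).
Proof. exact: filter_all. Qed.

Lemma erase_id w : isword n w -> erase w = w.
Proof. by move=> /all_filterP. Qed.

(** A cancellation made by [push] either is one allowed by [peq] or concerns two letters that are
    both erased. *)
Lemma peq_erase_rednf (w : word) : peq n rels (erase (rednf w)) (erase w).
Proof.
elim: w => [|l w IH] /=; first exact: peq_refl.
have h : peq n rels (erase (l :: rednf w)) (if l.1 < n then l :: erase w else erase w).
  by rewrite /=; case: ifP => _ //; apply: (peq_cat2l [:: l] IH).
apply: peq_trans h; case: (rednf w) => [|m w']; first exact: peq_refl.
rewrite {1}/push; case: eqP => [->|_]; last exact: peq_refl.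
rewrite /=; have [ln|_] := boolP (l.1 < n)%N; last exact: peq_refl.
by apply: peq_sym; apply: (peq_cancel rels [::]).
Qed.

Lemma peq_erase_wval (w : word) : peq n rels (erase (fgval (wval w))) (erase w).
Proof. by rewrite fgval_wval; apply: peq_erase_rednf. Qed.

Hypothesis rels_word : {in rels, forall r, isword n r}.

(** The elements whose erased word is trivial in the presentation form a normal subgroup containing
    the relators. *)
Lemma nclos_peq (g : freeg nat) :
  nclos (fun x => exists2 r, r \in rels & x = wval r) g -> peq n rels (erase (fgval g)) [::].
Proof.
move=> /(_ (fun g => peq n rels (erase (fgval g)) [::])); apply; last first.
  move=> _ [r rr ->]; apply: peq_trans (peq_erase_wval _) _.
  by rewrite erase_id ?rels_word // -[r]cats0; apply: (peq_rel n [::] [::]).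
have eM (x y : freeg nat) :
    peq n rels (erase (fgval (x * y))) (erase (fgval x) ++ erase (fgval y)).
  rewrite -{1}(wvalK x) -{1}(wvalK y) -wval_cat -filter_cat.
  exact: peq_erase_wval.
have eV (h : freeg nat) : erase (fgval h^-1) = winv (erase (fgval h)).
  by rewrite /= /erase /winv filter_rev filter_map.
split=> [|x y hx hy|x hx|x y hx].
- exact: peq_refl.
- apply: peq_trans (eM _ _) _; apply: peq_trans hy.
  exact: (peq_cat2r (erase (fgval y)) hx).
- rewrite eV; apply: peq_trans (peq_winvr (isword_erase (fgval x))).
  by apply: peq_sym; apply: (peq_cat2r (winv (erase (fgval x))) hx).
- rewrite conjgE; apply: peq_trans (eM _ _) _; rewrite eV.
  apply: peq_trans (peq_winvl (isword_erase (fgval y))); apply: peq_cat2l.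
  apply: peq_trans (eM _ _) _; exact: (peq_cat2r (erase (fgval y)) hx).
Qed.

Lemma eqmod_peq w1 w2 : isword n w1 -> isword n w2 ->
  eqmod (nclos (fun x => exists2 r, r \in rels & x = wval r)) (wval w1) (wval w2) ->
  peq n rels w1 w2.
Proof.
move=> n1 n2 /nclos_peq; rewrite -(wvalV w1) -wval_cat => h.
have {}h : peq n rels (winv w1 ++ w2) [::].
  apply: peq_trans h; apply: peq_sym; apply: peq_trans (peq_erase_wval _) _.
  rewrite erase_id; first exact: peq_refl.
  by rewrite /isword all_cat -/(isword n w2) n2 andbT; apply: isword_winv.
have := peq_cat2l w1 h; rewrite cats0 catA => h1.
apply: peq_sym; apply: peq_trans h1; apply: peq_sym.
exact: (peq_cat2r w2 (peq_winvr n1)).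
Qed.

End Words.

(** * From the free group back to the presentation of G *)

Lemma wval_relator (u v : word) : wval (relator u v) = rho 0%N 1%N (wval (u ++ v)).
Proof.
rewrite /relator wval_cat /rho; congr (_ * _).
Qed.

Lemma ncl_nclos e (u v r g : word) :
  Gncl e u v r g -> nclos (with_rho 0%N 1%N (wval (u ++ v)) (wval r)) (wval g).
Proof.
have nN := nclos_normal (with_rho 0%N 1%N (wval (u ++ v)) (wval r)).
elim=> {g} [||g h _ Ng _ Nh|g _ Ng|w g _ _ Ng|g h _ Ng gh].
- by apply: nclos_in; left.
- exact (normal1 nN).
- by rewrite (wval_cat g h); exact (normalM nN Ng Nh).
- by rewrite (wvalV g); exact (normalV nN Ng).
- by rewrite (wval_cat (winv w)) (wval_cat g) (wvalV w) -conjgE; exact (normalJ nN (wval w) Ng).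
- apply: (eqmod_normal nN _ Ng); apply: (peq_ncl nN _ gh) => _ /predU1P[->|//].
  by rewrite wval_relator; apply: nclos_in; right.
Qed.

Theorem mainTheorem1 (e : nat) (u v : word) (r s : word) :
  2 <= e ->
  yword e u -> yword e v -> reduced u -> reduced v -> u != [::] -> v != [::] ->
  (forall x y, x \in u -> y \in v -> x.1 != y.1) ->
  isword e.+2 r -> isword e.+2 s ->
  (forall g, Gncl e u v r g <-> Gncl e u v s g) ->
  exists w, isword e.+2 w /\
    (Geq e u v (winv w ++ r ++ w) s \/ Geq e u v (winv w ++ r ++ w) (winv s)).
Proof.
move=> _ yu yv _ _ _ _ _ nr ns Nrs.
have yuv : all (fun l : letter => 2 <= l.1 <= e.+1) (u ++ v) by rewrite all_cat; apply/andP; split.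
have rho_word : isword e.+2 (relator u v).
  by rewrite /isword /=; apply: sub_all yuv => l; lia.
have suv : supp (fun y => (y != 0%N) && (y != 1%N)) (wval (u ++ v)).
  by apply: supp_wval; apply: sub_all yuv => -[y c] /=; lia.
have [h rs] : relpm 0%N 1%N (wval (u ++ v)) (wval r) (wval s).
  apply: commutator_Magnus => //; apply: (ncl_nclos (e := e)); apply/Nrs; exact: ncl_base.
(* The conjugator may involve letters outside the presentation. Retracting onto the letters of [P]
   removes them and fixes [r], [s] and the relator. *)
pose P (y : nat) := (y < e.+2)%N; pose w := erase e.+2 (fgval h).
have nw : isword e.+2 w by apply: isword_erase.
have retP x : isword e.+2 x -> ret P (wval x) = wval x.
  by move=> nx; apply: suppP; apply: supp_wval.
have lift_eq x : isword e.+2 x -> eqmod (nclos1 (rho 0%N 1%N (wval (u ++ v)))) (wval r ^ h) (wval x) ->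
    Geq e u v (winv w ++ r ++ w) x.
  move=> nx rx; apply: eqmod_peq => //.
      by move=> x0; rewrite inE => /eqP ->.
    by rewrite /isword !all_cat -!/(isword _ _) nr nw isword_winv.
  have -> : wval (winv w ++ r ++ w) = ret P (wval r ^ h).
    by rewrite !wval_cat (wvalV w) retJ retP // -(wvalK h) ret_wval conjgE.
  rewrite -[wval x]retP // /eqmod -retV -retM.
  apply: (nclos_hom (f := ret P)) rx => _ <-; apply: nclos_in.
  exists (relator u v); first by rewrite inE.
  by rewrite -wval_relator -[LHS]/(ret P _) retP.
exists w; split=> //; case: rs => rs; [left | right]; apply: lift_eq => //.
  exact: isword_winv.
by rewrite (wvalV s).
Qed.
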